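(* For every positive integer $N$ there exists a topologically convex stacked polyhedron such that every valid edge unfolding of it (into possibly multiple non-self-overlapping pieces) has at least $N$ pieces.
   Context: A polyhedron is a compact subset of $\mathbb{R}^3$ whose boundary surface is a closed embedded surface made of finitely many planar polygonal faces meeting edge-to-edge. It is topologically convex if its surface is homeomorphic to a sphere and its graph of vertices and edges is a 3-vertex-connected planar graph. A stacked polyhedron is one that can be formed from a single tetrahedron by repeatedly gluing a new tetrahedron onto a single triangular face of the current stacked polyhedron, face to face, so that the result is again a polyhedron. An edge unfolding (possibly into multiple pieces) is specified by a set of edges (the cut edges). Cutting the surface along them separates it into connected pieces. The unfolding is valid if each piece can be laid out isometrically in the plane, face by face, as a simple (non-self-overlapping) polygon. *)

(* Defs.v *)
From HB Require Import structures.
From mathcomp Require Import all_boot all_order all_algebra.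
From mathcomp Require Import all_classical all_reals all_analysis.
Set Implicit Arguments. Unset Strict Implicit. Unset Printing Implicit Defensive.
Import Order.TTheory GRing.Theory Num.Theory.
Import numFieldNormedType.Exports.
Local Open Scope classical_set_scope.
Local Open Scope ring_scope.

Section Defs.
Variable R : realType.

Definition bary (m : nat) (S : {set 'I_m}) (lam : 'I_m -> R) : Prop :=
  (forall v, 0 <= lam v) /\ (forall v, v \notin S -> lam v = 0) /\
  \sum_v lam v = 1.

Definition comb (m k : nat) (q : 'I_m -> 'rV[R]_k) (lam : 'I_m -> R) : 'rV[R]_k :=
  \sum_v lam v *: q v.

Definition hull (m k : nat) (q : 'I_m -> 'rV[R]_k) (S : {set 'I_m}) : set 'rV[R]_k :=
  [set x | exists lam, bary S lam /\ x = comb q lam].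

Definition affindep (m k : nat) (q : 'I_m -> 'rV[R]_k) (S : {set 'I_m}) : Prop :=
  forall lam : 'I_m -> R, (forall v, v \notin S -> lam v = 0) ->
    \sum_v lam v = 0 -> comb q lam = 0 -> forall v, lam v = 0.

Definition d2 (k : nat) (x y : 'rV[R]_k) : R := \sum_i (x 0 i - y 0 i) ^+ 2.

Definition sphere2 : set 'rV[R]_3 := [set x | d2 x 0 = 1].
Definition disk2 : set 'rV[R]_2 := [set z | d2 z 0 <= 1].

Definition homeomorphic (T U : topologicalType) (A : set T) (B : set U) : Prop :=
  exists (f : T -> U) (g : U -> T),
    (forall x, A x -> B (f x)) /\ (forall y, B y -> A (g y)) /\
    (forall x, A x -> g (f x) = x) /\ (forall y, B y -> f (g y) = y) /\
    {within A, continuous f} /\ {within B, continuous g}.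

Definition surface_set (m : nat) (p : 'I_m -> 'rV[R]_3) (T : {set {set 'I_m}})
  : set 'rV[R]_3 := \bigcup_(F in [set F | F \in T]) hull p F.

(* embedded polyhedral surface whose faces are exactly the triangles of T:
   nondegenerate triangles, meeting only in common vertices/edges, and no two
   triangles sharing an edge are coplanar *)
Definition is_poly_surface (m : nat) (p : 'I_m -> 'rV[R]_3) (T : {set {set 'I_m}})
  : Prop :=
  (forall F, F \in T -> #|F| = 3%N /\ affindep p F) /\
  (forall F G, F \in T -> G \in T -> hull p F `&` hull p G = hull p (F :&: G)) /\
  (forall F G, F \in T -> G \in T -> #|F :&: G| = 2%N -> affindep p (F :|: G)).

(** * Stacked polyhedra: vertices 0..3 form the initial tetrahedron, vertex
    k+4 is the apex of the tetrahedron glued at step k onto face f k. *)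

Definition tet0 (n : nat) : {set 'I_n.+4} := [set i : 'I_n.+4 | (i < 4)%N].

Definition init_surf (n : nat) : {set {set 'I_n.+4}} :=
  [set A : {set 'I_n.+4} | (A \subset tet0 n) && (#|A| == 3%N)].

Definition apex (n k : nat) : 'I_n.+4 := inord (k + 4).

Fixpoint surf (n : nat) (f : nat -> {set 'I_n.+4}) (k : nat) : {set {set 'I_n.+4}} :=
  match k with
  | 0 => init_surf n
  | k'.+1 =>
      (surf f k' :\ f k') :|: [set (apex n k' |: (f k' :\ v)) | v in f k']
  end.

Definition tet (n : nat) (f : nat -> {set 'I_n.+4}) (k : nat) : {set 'I_n.+4} :=
  apex n k |: f k.

Definition solid (n : nat) (p : 'I_n.+4 -> 'rV[R]_3) (f : nat -> {set 'I_n.+4})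
  (k : nat) : set 'rV[R]_3 :=
  hull p (tet0 n) `|` \bigcup_(j in [set j : nat | (j < k)%N]) hull p (tet f j).

Definition stacked (n : nat) (p : 'I_n.+4 -> 'rV[R]_3) (f : nat -> {set 'I_n.+4})
  : Prop :=
  affindep p (tet0 n) /\
  (forall k, (k < n)%N ->
     f k \in surf f k /\ affindep p (tet f k) /\
     hull p (tet f k) `&` solid p f k `<=` hull p (f k)) /\
  (forall k, (k <= n)%N -> is_poly_surface p (surf f k)).

Definition sadj (m : nat) (T : {set {set 'I_m}}) : rel 'I_m :=
  fun u v => (u != v) && [exists F in T, (u \in F) && (v \in F)].

Definition three_connected (m : nat) (e : rel 'I_m) : Prop :=
  (3 < m)%N /\
  forall S : {set 'I_m}, (#|S| <= 2)%N -> forall u v, u \notin S -> v \notin S ->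
    connect (fun a b => [&& e a b, a \notin S & b \notin S]) u v.

Definition top_convex (m : nat) (p : 'I_m -> 'rV[R]_3) (T : {set {set 'I_m}}) : Prop :=
  homeomorphic (surface_set p T) sphere2 /\ three_connected (sadj T).

Definition sedges (m : nat) (T : {set {set 'I_m}}) : {set {set 'I_m}} :=
  [set e : {set 'I_m} | (#|e| == 2%N) && [exists F in T, e \subset F]].

Definition fadj (m : nat) (T C : {set {set 'I_m}}) : rel {set 'I_m} :=
  fun F G => [&& F \in T, G \in T, F != G, #|F :&: G| == 2%N & (F :&: G) \notin C].

Definition pieces (m : nat) (T C : {set {set 'I_m}}) : {set {set {set 'I_m}}} :=
  [set [set G in T | connect (fadj T C) F G] | F in T].

(* faces F, G containing the 3D point x are identified at x in the cut
   surface: they are linked by a chain of faces glued along uncut edges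
   whose closed segment contains x *)
Definition glued_at (m : nat) (p : 'I_m -> 'rV[R]_3) (T C : {set {set 'I_m}})
  (x : 'rV[R]_3) (F G : {set 'I_m}) : Prop :=
  connect (fun A B => `[< fadj T C A B /\ hull p (A :&: B) x >]) F G.

(* a planar layout of the piece P, face by face: L F v is the position of
   vertex v of face F *)
Definition good_layout (m : nat) (p : 'I_m -> 'rV[R]_3) (T C : {set {set 'I_m}})
  (P : {set {set 'I_m}}) (L : {set 'I_m} -> 'I_m -> 'rV[R]_2) : Prop :=
  (forall F, F \in P -> forall u v, u \in F -> v \in F ->
     d2 (L F u) (L F v) = d2 (p u) (p v)) /\
  (forall F G, F \in P -> G \in P -> fadj T C F G ->
     forall v, v \in F :&: G -> L F v = L G v) /\
  (* no overlap: the layout is injective on the cut-open piece *)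
  (forall F G, F \in P -> G \in P -> forall lam mu, bary F lam -> bary G mu ->
     comb (L F) lam = comb (L G) mu ->
     comb p lam = comb p mu /\ glued_at p T C (comb p lam) F G) /\
  (* the image is a simple polygon (a region homeomorphic to a closed disk) *)
  homeomorphic (\bigcup_(F in [set F | F \in P]) hull (L F) F) disk2.

Definition valid_unfolding (m : nat) (p : 'I_m -> 'rV[R]_3) (T C : {set {set 'I_m}})
  : Prop :=
  C \subset sedges T /\
  forall P, P \in pieces T C -> exists L, good_layout p T C P L.

End Defs.

(* Main.v *)
Require Import Defs.
From HB Require Import structures.
From mathcomp Require Import all_boot all_order all_algebra.
From mathcomp Require Import all_classical all_reals all_analysis.
From mathcomp Require Import zify ring lra.
From mathcomp Require Import fintype finset.
Set Implicit Arguments. Unset Strict Implicit. Unset Printing Implicit Defensive.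
Import Order.TTheory GRing.Theory Num.Theory.
Import numFieldNormedType.Exports.
Local Open Scope ring_scope.

(* All vertices are positive combinations of the face they are glued onto, with coefficient
   sum larger than 1, so every intermediate polyhedron is star-shaped about the origin:
   conic representations over its faces exist and are unique, which gives all the
   intersection conditions, and radial projection is a homeomorphism with the sphere.

   The base is a book of tetrahedra with two deep vertices A, B (the hubs) and a rising
   chain w_0, w_1, ... in the plane of symmetry, w_{j+1} = (A + B + w_j) / 2; the faces
   A w_j w_{j+1} and B w_j w_{j+1} carry tall spikes with tips A + w_j + w_{j+1} and
   B + w_j + w_{j+1}.  If two adjacent edges at a vertex are both uncut, the three
   consecutive faces they glue must have angle sum at most 2 pi; the steep angles at the
   w_j violate this at one corner of all but boundedly many faces, which thus have a cut edge.
   Each tip has a cut edge because a tetrahedron corner cannot be flattened, and combining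
   these constraints one face among any two consecutive spikes has at least two cut edges.

   The pieces are the components of the dual graph, in which a face with c cut edges has
   degree at most 3 - c.  A graph has at least sum_F (1 - deg F / 2) components, so the
   number of pieces is at least half the sum of c - 1 over all faces, which grows linearly
   with the length of the chain. *)

(** * Star-shaped triangulated surfaces *)

(** Angles never occur as numbers. A layout is only known to be injective on the points of its
    faces, so an angle excess must become an explicit common point of two laid-out triangles: a
    vector identity with nonnegative weights, one of them positive at a vertex outside the other
    face. Angle bounds enter as inequalities between dot products and squared lengths.

    The chain converges to (0, 0, 20). Seen from there a hub lies 10 below and a tip 30 above, both
    displaced sideways by 1 only and to the same side, so the face angle between them is almost pi.
    The chain direction (1, 0, -2) is a compromise. It is tilted enough that its acute angle with a
    spike edge still exceeds 2 pi when added to two almost flat angles; it is steep enough that its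
    obtuse angle with a spike edge has squared cosine at least 3/4.

    All chain vertices are collinear, so consecutive side faces at one hub would be coplanar. Each
    round of gluing therefore covers both side faces by spikes before the chain is prolonged. *)

Section Comb.
Variables (R : realType) (m k : nat) (p : 'I_m -> 'rV[R]_k).
Implicit Types (lam mu : 'I_m -> R) (F G : {set 'I_m}).

Lemma eq_comb lam mu : lam =1 mu -> comb p lam = comb p mu.
Proof. by move=> e; apply: eq_bigr => v _; rewrite e. Qed.

Lemma combD a lam mu : comb p (fun v => lam v + a * mu v) = comb p lam + a *: comb p mu.
Proof.
rewrite /comb scaler_sumr -big_split /=; apply: eq_bigr => v _.
by rewrite scalerDl scalerA.
Qed.

Lemma combZ a lam : comb p (fun v => a * lam v) = a *: comb p lam.
Proof. by rewrite /comb scaler_sumr; apply: eq_bigr => v _; rewrite scalerA. Qed.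

Lemma combB lam mu : comb p (fun v => lam v - mu v) = comb p lam - comb p mu.
Proof. by rewrite -scaleN1r -combD; apply: eq_comb => v; rewrite mulN1r. Qed.

Lemma comb_delta u : comb p (fun v => (v == u)%:R) = p u.
Proof.
rewrite /comb (bigD1 u) //= eqxx scale1r big1 ?addr0 // => v /negPf ->.
by rewrite scale0r.
Qed.

Lemma comb0 : comb p (fun _ => 0) = 0.
Proof. by rewrite /comb big1 // => v _; rewrite scale0r. Qed.

Lemma sumB (lam mu : 'I_m -> R) : \sum_v (lam v - mu v) = \sum_v lam v - \sum_v mu v.
Proof. by rewrite big_split /= sumrN. Qed.

Lemma sum_supp F lam : (forall v, v \notin F -> lam v = 0) ->
  \sum_v lam v = \sum_(v in F) lam v.
Proof. by move=> h; rewrite [RHS]big_mkcond; apply: eq_bigr => v _; case: ifPn => // /h. Qed.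

Lemma comb_supp F lam : (forall v, v \notin F -> lam v = 0) ->
  comb p lam = \sum_(v in F) lam v *: p v.
Proof.
move=> h; rewrite /comb [RHS]big_mkcond; apply: eq_bigr => v _.
by case: ifPn => // /h ->; rewrite scale0r.
Qed.

Definition conic F lam := (forall v, 0 <= lam v) /\ (forall v, v \notin F -> lam v = 0).

Lemma conicS F G lam : F \subset G -> conic F lam -> conic G lam.
Proof. by move=> /subsetP s [h1 h2]; split=> // v vG; apply: h2; apply: contra vG; apply: s. Qed.

Lemma baryP F lam : bary F lam <-> conic F lam /\ \sum_v lam v = 1.
Proof. by split=> [[h1 [h2 h3]]|[[h1 h2] h3]]. Qed.

Lemma bary_sub F G lam : F \subset G -> bary F lam -> bary G lam.
Proof. by move=> s /baryP[c e]; apply/baryP; split=> //; apply: conicS c. Qed.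

Lemma hullS F G : F \subset G -> (hull p F `<=` hull p G)%classic.
Proof. by move=> s x [lam [b e]]; exists lam; split=> //; apply: bary_sub b. Qed.

End Comb.

(** * Complete simplicial fans and their stellar subdivisions *)

Section Fan.
Variables (R : realType) (m : nat) (p : 'I_m -> 'rV[R]_3).
Implicit Types (lam mu : 'I_m -> R) (F G : {set 'I_m}) (T : {set {set 'I_m}}).

(** The cones over the faces meet only in cones over common faces. Asking for equal coefficient
    functions turns every intersection claim into a comparison of supports. *)
Definition fan_unique T := forall F G lam mu, F \in T -> G \in T ->
  conic F lam -> conic G mu -> comb p lam = comb p mu -> lam =1 mu.

Definition fan_cover T := forall x, exists F lam, [/\ F \in T, conic F lam & x = comb p lam].

(** The positive and negative parts of a linear relation on [F] are two conic representations of one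
    point. *)
Lemma fan_indep T F lam : fan_unique T -> F \in T ->
  (forall v, v \notin F -> lam v = 0) -> comb p lam = 0 -> forall v, lam v = 0.
Proof.
move=> uT FT supp e0.
pose lp v := Num.max (lam v) 0; pose ln v := Num.max (- lam v) 0.
have lpn v : lam v = lp v - ln v.
  by rewrite /lp /ln; case: (leP (lam v) 0) => h; case: (leP (- lam v) 0) => h'; lra.
have cp : conic F lp.
  by split=> v; [rewrite /lp le_max lexx orbT | move=> /supp; rewrite /lp => ->; rewrite maxxx].
have cn : conic F ln.
  by split=> v; [rewrite /ln le_max lexx orbT | move=> /supp; rewrite /ln => ->; rewrite oppr0 maxxx].
have e : comb p lp = comb p ln.
  by apply/eqP; rewrite -subr_eq0 -combB -e0; apply/eqP/eq_comb => v; rewrite lpn.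
by move=> v; rewrite lpn (uT _ _ _ _ FT FT cp cn e) subrr.
Qed.

Lemma fan_affindep T F : fan_unique T -> F \in T -> affindep p F.
Proof. by move=> uT FT lam supp _; apply: (fan_indep uT FT). Qed.

Lemma fan_hullI T F G : fan_unique T -> F \in T -> G \in T ->
  (hull p F `&` hull p G = hull p (F :&: G))%classic.
Proof.
move=> uT FT GT; rewrite classical_sets.eqEsubset; split=> [x [] [lam [/baryP[cl sl] ex]] [mu [/baryP[cm sm] ey]]|x hx].
  exists lam; split=> //; apply/baryP; split=> //; split; first by case: cl.
  have e := uT _ _ _ _ FT GT cl cm (etrans (esym ex) ey).
  by move=> v; rewrite inE negb_and => /orP[/(proj2 cl)//|/(proj2 cm)]; rewrite e.
by split; apply: hullS hx; rewrite (subsetIl,subsetIr).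
Qed.

(** The vertices of [G] are linearly independent and its plane is where the coordinates sum to 1; a
    coordinate sum other than 1 puts [p a] off that plane. *)
Lemma fan_affindepU1 T G a (d : 'I_m -> R) : fan_unique T -> G \in T -> a \notin G ->
  (forall v, v \notin G -> d v = 0) -> p a = comb p d -> \sum_v d v != 1 ->
  affindep p (a |: G).
Proof.
move=> uT GT aG dG pa sd lam supp s0 e0.
have da : d a = 0 by apply: dG.
pose mu v := lam v + lam a * (d v - (v == a)%:R).
have mu0 : forall v, mu v = 0.
  apply: (fan_indep uT GT) => [v vG|].
    rewrite /mu; have [->|va] := eqVneq v a; first by rewrite da /=; ring.
    by rewrite supp ?dG ?inE ?negb_or ?va // /=; ring.
  by rewrite combD combB comb_delta -pa e0 subrr scaler0 addr0.
have : \sum_v mu v = 0 by rewrite big1.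
rewrite big_split /= -mulr_sumr sumB s0 add0r.
have -> : \sum_v (v == a)%:R = 1 :> R.
  by rewrite (bigD1 a) //= eqxx big1 ?addr0 // => v /negPf ->.
move/eqP; rewrite mulf_eq0 subr_eq0 (negPf sd) orbF => /eqP la v.
by have := mu0 v; rewrite /mu la mul0r addr0.
Qed.

Section Step.
Variables (T : {set {set 'I_m}}) (f : {set 'I_m}) (a : 'I_m) (c : 'I_m -> R).
Hypothesis T3 : forall F, F \in T -> #|F| = 3%N.
Hypothesis fT : f \in T.
Hypothesis aT : forall F, F \in T -> a \notin F.
Hypothesis c_gt0 : forall v, v \in f -> 0 < c v.
Hypothesis c_out : forall v, v \notin f -> c v = 0.
Hypothesis pa : p a = comb p c.
Hypothesis c_sum : 1 < \sum_v c v.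

Definition stellar : {set {set 'I_m}} := (T :\ f) :|: [set a |: (f :\ v) | v in f].
(** The linear relation created by the apex. Its positive coefficient sum says that the apex lies
    beyond the plane of [f] as seen from the origin. *)
Let dl v := c v - (v == a)%:R.

Let ca : c a = 0. Proof. by apply: c_out; apply: aT. Qed.
Let comb_dl : comb p dl = 0. Proof. by rewrite combB comb_delta -pa subrr. Qed.
Let sum_dl : 0 < \sum_v dl v.
Proof.
rewrite sumB (bigD1 a (F := fun v => (v == a)%:R)) //= eqxx.
by rewrite (big1 _ (fun v => v != a)) ?addr0 ?subr_gt0 // => v /negPf ->.
Qed.

Lemma stellar_misses F : F \in stellar -> exists2 v, v \in f & v \notin F.
Proof.
rewrite !inE => /orP[/andP[Ff FT]|/imsetP[v vf ->]].
  suff /subsetPn : ~~ (f \subset F) by [].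
  by apply: contra Ff => /subset_leqif_cards[_]; rewrite !T3 // eqxx eq_sym => /esym.
exists v => //; rewrite !inE eqxx /= orbF.
by apply: contraTneq vf => ->; apply: aT.
Qed.

Lemma stellar_collapse F lam : F \in stellar -> conic F lam ->
  exists2 G, G \in T & conic G (fun v => lam v + lam a * dl v).
Proof.
move=> FT' [l0 lF]; move: (FT'); rewrite !inE => /orP[/andP[Ff FT]|/imsetP[v vf eF]].
  by exists F => //; rewrite (lF a (aT FT)); split=> v; rewrite mul0r addr0 //; apply: lF.
exists f => //; split=> [u|u uf]; rewrite /dl; have [->|ua] := eqVneq u a.
- by rewrite ca /=; lra.
- rewrite subr0; apply: addr_ge0 => //; apply: mulr_ge0 => //.
  by have [/c_gt0/ltW|/c_out->] := boolP (u \in f).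
- by rewrite ca /=; ring.
by rewrite c_out // lF ?eF ?inE ?negb_or ?negb_and ?ua ?uf ?orbT // /=; ring.
Qed.

(** Eliminating [a] through [dl] puts both representations into the old fan, so they differ by a
    multiple of [dl]. Each stellar face misses a vertex of [f], where [dl] is positive, which bounds
    that multiple from both sides. *)
Lemma stellar_unique : fan_unique T -> fan_unique stellar.
Proof.
move=> uT F G lam mu FT GT cl cm e.
have [F' F'T cF] := stellar_collapse FT cl.
have [G' G'T cG] := stellar_collapse GT cm.
have e' v : lam v + lam a * dl v = mu v + mu a * dl v.
  by apply: (uT _ _ _ _ F'T G'T cF cG); rewrite !combD comb_dl !scaler0 !addr0.
suff ea : lam a = mu a by move=> v; move: (e' v); rewrite ea => /addIr.
have half H l l' : H \in stellar -> conic H l -> (forall v, 0 <= l' v) ->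
    (forall v, l v + l a * dl v = l' v + l' a * dl v) -> l' a <= l a.
  move=> HT cH l'0 ee; have [v vf vH] := stellar_misses HT.
  have va : (v == a) = false by apply: contraTF vf => /eqP->; apply: aT.
  move: (ee v); rewrite (proj2 cH) // add0r /dl va subr0 => h.
  by rewrite -(ler_pM2r (c_gt0 vf)) h lerDr.
apply/le_anti/andP; split.
  by apply: (half G mu lam) => //; case: cl.
by apply: (half F lam mu) => //; case: cm.
Qed.

(* Subtract the largest admissible multiple of the relation [dl]; its coefficient sum is
   positive, so the gauge does not increase. *)
Lemma stellar_expand lam : conic (a |: f) lam ->
  exists F mu, [/\ F \in stellar, conic F mu, comb p mu = comb p lam &
    \sum_v mu v <= \sum_v lam v].
Proof.
move=> [l0 lf].
have [v0 v0f] : exists v, v \in f by apply/card_gt0P; rewrite T3.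
case: (@arg_minP _ _ _ v0 (fun v => v \in f) (fun v => lam v / c v) v0f) => w wf wmin.
set s := lam w / c w.
have s0 : 0 <= s by apply: divr_ge0 => //; apply/ltW/c_gt0.
have wa : (w == a) = false by apply: contraTF wf => /eqP->; apply: aT.
exists (a |: (f :\ w)), (fun v => lam v + (- s) * dl v); split.
- by rewrite inE; apply/orP; right; apply/imsetP; exists w.
- split=> v; rewrite /dl.
    have [->|va] := eqVneq v a; first by rewrite ca /=; have := l0 a; lra.
    rewrite subr0; have [vf|vf] := boolP (v \in f); last by rewrite c_out // mulr0 addr0.
    rewrite mulNr subr_ge0 -ler_pdivlMr ?c_gt0 //; exact: wmin.
  rewrite !inE !negb_or negb_and negbK => /andP[va /orP[/eqP->|vf]].
    by rewrite wa /s subr0 mulNr divfK ?subrr // gt_eqF ?c_gt0.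
  by rewrite (negPf va) c_out // lf ?inE ?negb_or ?va // /=; ring.
- by rewrite combD comb_dl scaler0 addr0.
by rewrite big_split /= -mulr_sumr gerDl mulNr oppr_le0 mulr_ge0 // ltW.
Qed.

Lemma stellar_push F lam : F \in T -> conic F lam ->
  exists G mu, [/\ G \in stellar, conic G mu, comb p mu = comb p lam &
    \sum_v mu v <= \sum_v lam v].
Proof.
move=> FT cl; have [eF|Ff] := eqVneq F f.
  by apply: stellar_expand; apply: conicS cl; rewrite eF subsetUr.
by exists F, lam; split=> //; rewrite !inE Ff FT.
Qed.

Lemma stellar_cover : fan_cover T -> fan_cover stellar.
Proof.
move=> cT x; have [F [lam [FT cl ->]]] := cT x.
by have [G [mu [GT cm e _]]] := stellar_push FT cl; exists G, mu.
Qed.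

Lemma stellar_tet_affindep : fan_unique T -> affindep p (a |: f).
Proof.
move=> uT; apply: (fan_affindepU1 uT fT (aT fT) c_out pa).
by rewrite gt_eqF.
Qed.

(** The coefficient sum over the fan is the gauge of the star-shaped solid. Eliminating [a] gives a
    point of the new tetrahedron the gauge 1 plus [lam a] times a positive number, so gauge at most
    1 forces [lam a = 0]. *)
Lemma stellar_solidI (X : set 'rV[R]_3) : fan_unique T ->
  (forall x, X x -> exists F lam, [/\ F \in T, conic F lam, x = comb p lam & \sum_v lam v <= 1]) ->
  (hull p (a |: f) `&` X `<=` hull p f)%classic.
Proof.
move=> uT hX x [[lam [/baryP[[l0 lf] sl] ex]] /hX[F [mu [FT cm ex' sm]]]].
have cl : conic f (fun v => lam v + lam a * dl v).
  split=> v; rewrite /dl; have [->|va] := eqVneq v a.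
  - by rewrite ca /=; lra.
  - rewrite subr0; apply: addr_ge0 => //; apply: mulr_ge0 => //.
    by have [/c_gt0/ltW|/c_out->] := boolP (v \in f).
  - by move=> _; rewrite ca /=; ring.
  by move=> vf; rewrite c_out // lf ?inE ?negb_or ?va // /=; ring.
have e : mu =1 (fun v => lam v + lam a * dl v).
  by apply: (uT _ _ _ _ FT fT cm cl); rewrite combD comb_dl scaler0 addr0 -ex' -ex.
have la : lam a = 0.
  move: sm; rewrite (eq_bigr _ (fun v _ => e v)) big_split /= sl -mulr_sumr.
  rewrite gerDl pmulr_lle0 // => h; by apply/le_anti; rewrite h l0.
exists lam; split=> //; apply/baryP; split=> //; split=> // v vf.
by have [->|va] := eqVneq v a => //; apply: lf; rewrite !inE negb_or va.
Qed.

End Step.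

Section Base.
Variables (t0 : {set 'I_m}).
Hypothesis t04 : #|t0| = 4%N.
Hypothesis span0 : forall x, exists2 lam, (forall v, v \notin t0 -> lam v = 0) & comb p lam = x.
Hypothesis rel0 : comb p (fun v => (v \in t0)%:R) = 0.
Hypothesis ker0 : forall lam, (forall v, v \notin t0 -> lam v = 0) -> comb p lam = 0 ->
  exists a, forall v, v \in t0 -> lam v = a.

Let T0 : {set {set 'I_m}} := [set A : {set 'I_m} | (A \subset t0) && (#|A| == 3%N)].

Lemma base_affindep : affindep p t0.
Proof.
move=> lam supp s0 e0; have [a ha] := ker0 supp e0.
have a0 : a = 0.
  move: s0; rewrite (sum_supp supp) (eq_bigr _ ha) sumr_const t04 => /eqP.
  by rewrite mulrn_eq0 => /eqP.
by move=> v; have [/ha->|/supp] := boolP (v \in t0).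
Qed.

Lemma base_misses F : F \in T0 -> exists2 v, v \in t0 & v \notin F.
Proof.
rewrite inE => /andP[Ft F3]; suff /subsetPn : ~~ (t0 \subset F) by [].
by apply/negP => /subset_leq_card; rewrite t04 (eqP F3).
Qed.

(** Two representations differ by a constant on [t0]; a vertex missed by [F] and one missed by [G]
    bound this constant by 0 from opposite sides. *)
Lemma base_unique : fan_unique T0.
Proof.
move=> F G lam mu FT GT cl cm e.
have [Ft Gt] : F \subset t0 /\ G \subset t0.
  by move: FT GT; rewrite !inE => /andP[-> _] /andP[-> _].
have [l0 lt] := conicS Ft cl; have [m0 mt] := conicS Gt cm.
have [||a ha] := @ker0 (fun v => lam v - mu v).
- by move=> v vt; rewrite lt ?mt ?subrr.
- by rewrite combB e subrr.
have [v vt vF] := base_misses FT; have [u ut uG] := base_misses GT.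
have a0 : a = 0.
  apply/le_anti; rewrite -{1}(ha _ vt) -(ha _ ut) (proj2 cl v) // (proj2 cm u) //.
  by rewrite sub0r subr0 oppr_le0 m0 l0.
by move=> w; have [/ha/eqP|wt] := boolP (w \in t0); [rewrite a0 subr_eq0 => /eqP | rewrite lt ?mt].
Qed.

(** Subtracting the least coefficient times [rel0] empties one vertex, and [s] is four times that
    coefficient. Covering uses this with arbitrary signs, the gauge bound with nonnegative
    coefficients. *)
Lemma base_push lam : (forall v, v \notin t0 -> lam v = 0) ->
  exists F mu s, [/\ F \in T0, conic F mu, comb p mu = comb p lam,
    \sum_v mu v = \sum_v lam v - s & (forall v, 0 <= lam v) -> 0 <= s].
Proof.
move=> supp; have [v0 v0t] : exists v, v \in t0 by apply/card_gt0P; rewrite t04.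
case: (@arg_minP _ _ _ v0 (fun v => v \in t0) lam v0t) => w wt wmin.
exists (t0 :\ w), (fun v => lam v + (- lam w) * (v \in t0)%:R), (lam w *+ 4); split.
- by rewrite inE subD1set /= -(eqn_add2l (w \in t0)) -cardsD1 t04 wt.
- split=> v.
    have [vt|vt] := boolP (v \in t0); first by rewrite mulr1 subr_ge0 wmin.
    by rewrite mulr0 addr0 supp.
  rewrite !inE negb_and negbK => /orP[/eqP->|vt]; first by rewrite wt mulr1 subrr.
  by rewrite (negPf vt) supp // mulr0 addr0.
- by rewrite combD rel0 scaler0 addr0.
- rewrite big_split /= -mulr_sumr; congr (_ + _).
  rewrite (@sum_supp _ _ t0) => [|v /negPf->//].
  by rewrite (eq_bigr (fun=> 1)) => [|v ->//]; rewrite sumr_const t04 mulNr mulr_natr.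
by move=> h; apply: mulrn_wge0.
Qed.

Lemma base_cover : fan_cover T0.
Proof.
move=> x; have [lam supp <-] := span0 x.
by have [F [mu [s [FT cm <- _ _]]]] := base_push supp; exists F, mu.
Qed.

End Base.
End Fan.

Lemma card_rem1 (X : finType) (A : {set X}) x k : x \in A -> #|A| = k.+1 -> #|A :\ x| = k.
Proof. by rewrite (cardsD1 x) => ->; rewrite add1n => -[]. Qed.

(** * Every edge lies in at most two faces *)

Section Manifold.
Variable m : nat.
Implicit Types (e F G f : {set 'I_m}) (T : {set {set 'I_m}}).

Definition manifold T := forall e, #|e| = 2%N -> (#|[set F in T | e \subset F]| <= 2)%N.

(** Only edges at [a] or inside [f] change. An edge from [a] to a vertex [u] of [f] lies in the two
    new faces that omit another vertex of [f]; an edge of [f] exchanges [f] for one new face. *)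
Lemma stellar_manifold T f a : f \in T -> #|f| = 3%N ->
  (forall F, F \in T -> a \notin F) -> manifold T -> manifold (stellar T f a).
Proof.
move=> fT f3 aT mT e e2.
have newP F : F \in stellar T f a -> F \in T :\ f \/ exists2 v, v \in f & F = a |: (f :\ v).
  by rewrite in_setU => /orP[|/imsetP[v vf ->]]; [left|right; exists v].
have [ae|ae] := boolP (a \in e).
  have [u ue] : exists u, u \in e :\ a.
    by apply/card_gt0P; rewrite (card_rem1 ae e2).
  have [uf|uf] := boolP (u \in f).
    have c2 := card_rem1 uf f3.
    apply: leq_trans (leq_trans (leq_imset_card (fun v => a |: (f :\ v)) (mem (f :\ u))) _); last by rewrite c2.
    apply: subset_leq_card; apply/subsetP => F; rewrite inE => /andP[/newP[Fo|[v vf ->]] eF].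
      by move: Fo; rewrite in_setD1 => /andP[_ /aT]; rewrite (subsetP eF).
    apply: imset_f; rewrite !inE vf andbT.
    move: ue; rewrite !inE => /andP[ua /(subsetP eF)].
    by rewrite !inE (negPf ua) /= eq_sym => /andP[].
  rewrite (_ : [set F in _ | _] = set0) ?cards0 //.
  apply/setP => F; rewrite !inE; apply/negP => /andP[FT eF].
  move: ue; rewrite !inE => /andP[ua /(subsetP eF) uF].
  case/orP: FT => [/andP[_ /aT]|/imsetP[v vf eq]]; first by rewrite (subsetP eF).
  by move: uF uf; rewrite eq !inE (negPf ua) /= => /andP[_ ->].
have newe v : v \in f -> e \subset a |: (f :\ v) -> e = f :\ v.
  move=> vf es; apply/eqP; rewrite eqEcard; apply/andP; split; last first.
    by rewrite (card_rem1 vf f3) e2.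
  apply/subsetP => x xe; move: (subsetP es _ xe); rewrite in_setU1.
  by case/orP => // /eqP xa; move: ae; rewrite -xa xe.
have [ef|ef] := boolP (e \subset f); last first.
  apply: leq_trans (mT e e2); apply: subset_leq_card; apply/subsetP => F.
  rewrite !inE => /andP[FT eF]; rewrite eF andbT.
  case/orP: FT => [/andP[]//|/imsetP[v vf eq]].
  by move: ef; rewrite (newe v vf) ?subD1set // -eq.
have [v0 v0f v0e] : exists2 v, v \in f & v \notin e.
  by apply/subsetPn/negP => /subset_leq_card; rewrite e2 f3.
apply: (@leq_trans #|(a |: (f :\ v0)) |: ([set F in T | e \subset F] :\ f)|).
  apply: subset_leq_card; apply/subsetP => F.
  rewrite in_set => /andP[/newP[Fo|[v vf eF]] es].
    by move: Fo; rewrite !inE es andbT => /andP[-> ->]; rewrite orbT.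
  suff -> : v0 = v by rewrite eF !inE eqxx.
  rewrite eF in es; move: v0e; rewrite (newe v vf es) !inE v0f andbT negbK.
  by move/eqP.
apply: leq_trans (leq_card_setU _ _) _; rewrite cards1.
have fS : f \in [set F in T | e \subset F] by rewrite inE fT.
by have := mT e e2; rewrite (cardsD1 f [set F in T | e \subset F]) fS.
Qed.

End Manifold.

(** * Stacked polyhedra obtained from fans *)

Section Stack.
Variables (R : realType) (n : nat) (p : 'I_n.+4 -> 'rV[R]_3) (f : nat -> {set 'I_n.+4}).
Variable c : nat -> 'I_n.+4 -> R.
Notation a k := (apex n k).
Notation T k := (surf f k).

Hypothesis span0 : forall x, exists2 lam, (forall v, v \notin tet0 n -> lam v = 0) & comb p lam = x.
Hypothesis rel0 : comb p (fun v => (v \in tet0 n)%:R) = 0.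
Hypothesis ker0 : forall lam, (forall v, v \notin tet0 n -> lam v = 0) -> comb p lam = 0 ->
  exists a, forall v, v \in tet0 n -> lam v = a.
Hypothesis f_in : forall k, (k < n)%N -> f k \in T k.
Hypothesis c_gt0 : forall k, (k < n)%N -> forall v, v \in f k -> 0 < c k v.
Hypothesis c_out : forall k, (k < n)%N -> forall v, v \notin f k -> c k v = 0.
Hypothesis p_apex : forall k, (k < n)%N -> p (a k) = comb p (c k).
Hypothesis c_sum : forall k, (k < n)%N -> 1 < \sum_v c k v.
(** The coplanarity condition that star-shapedness does not supply: the apex avoids the plane of the
    old face across each edge of the glued face. *)
Hypothesis nbr : forall k, (k < n)%N -> forall v, v \in f k -> exists G d,
  [/\ G \in T k, G != f k, f k :\ v \subset G &
   [/\ forall u, u \notin G -> d u = 0, p (a k) = comb p d & \sum_u d u != 1]].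

Lemma card_tet0 : #|tet0 n| = 4%N.
Proof.
have h : (4 <= n.+4)%N by [].
rewrite -sum1_card (eq_bigl (fun i : 'I_n.+4 => (i < 4)%N)) => [|i]; last by rewrite inE.
by rewrite (big_ord_narrow h) sum1_card card_ord.
Qed.

Lemma apexE k : (k < n)%N -> a k = (k + 4)%N :> nat.
Proof. by move=> kn; rewrite inordK //; lia. Qed.

Lemma surfS k : T k.+1 = stellar (T k) (f k) (a k). Proof. by []. Qed.

Lemma surf_lt k F v : (k <= n)%N -> F \in T k -> v \in F -> (v < k + 4)%N.
Proof.
elim: k F v => [|k IH] F v kn.
  by rewrite inE => /andP[/subsetP h _] /h; rewrite inE.
rewrite surfS inE => /orP[|/imsetP[u uf ->]].
  by rewrite inE => /andP[_ FT] vF; have := IH _ _ (ltnW kn) FT vF; lia.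
rewrite !inE => /orP[/eqP->|/andP[_ vf]]; first by rewrite apexE //; lia.
by have := IH _ _ (ltnW kn) (f_in kn) vf; lia.
Qed.

Lemma apex_notin k F : (k < n)%N -> F \in T k -> a k \notin F.
Proof. by move=> kn FT; apply/negP => /(surf_lt (ltnW kn) FT); rewrite apexE // ltnn. Qed.

Lemma surf_card3 k F : (k <= n)%N -> F \in T k -> #|F| = 3%N.
Proof.
elim: k F => [|k IH] F kn; first by rewrite inE => /andP[_ /eqP].
rewrite surfS inE => /orP[|/imsetP[u uf ->]].
  by rewrite inE => /andP[_ /IH->] //; apply: ltnW.
have f3 := IH _ (ltnW kn) (f_in kn).
rewrite cardsU1 !inE (negPf (apex_notin kn (f_in kn))) andbF /=.
by rewrite (card_rem1 uf f3).
Qed.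

Lemma surf_unique k : (k <= n)%N -> fan_unique p (T k).
Proof.
elim: k => [|k IH] kn; first exact: (base_unique card_tet0 ker0).
rewrite surfS; apply: (stellar_unique (c := c k)); try by move=> *; apply: IH; apply: ltnW.
- by move=> F; apply: surf_card3; apply: ltnW.
- exact: f_in.
- by move=> F; apply: apex_notin.
- exact: c_gt0.
- exact: c_out.
- exact: p_apex.
- exact: IH (ltnW kn).
Qed.

Lemma surf_cover k : (k <= n)%N -> fan_cover p (T k).
Proof.
elim: k => [|k IH] kn; first exact: (base_cover card_tet0 span0 rel0).
rewrite surfS; apply: (stellar_cover (c := c k)).
- by move=> F; apply: surf_card3; apply: ltnW.
- exact: f_in.
- by move=> F; apply: apex_notin.
- exact: c_gt0.
- exact: c_out.
- exact: p_apex.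
- exact: c_sum.
- exact: IH (ltnW kn).
Qed.

Lemma surf_manifold k : (k <= n)%N -> manifold (T k).
Proof.
elim: k => [|k IH] kn; last first.
  rewrite surfS; apply: stellar_manifold (f_in kn) _ _ (IH (ltnW kn)).
    by apply: surf_card3 (f_in kn); apply: ltnW.
  by move=> F; apply: apex_notin.
move=> e e2; have [es|es] := boolP (e \subset tet0 n); last first.
  rewrite (_ : [set F in _ | _] = set0) ?cards0 //.
  apply/setP => F; rewrite !inE; apply/negP => /andP[/andP[Ft _] eF].
  by move: es; rewrite (subset_trans eF Ft).
have c2 : #|tet0 n :\: e| = 2%N.
  by have := cardsID e (tet0 n); rewrite (setIidPr es) card_tet0 e2; lia.
apply: leq_trans (leq_trans (leq_imset_card (fun v => v |: e) (mem (tet0 n :\: e))) _); last by rewrite c2.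
apply: subset_leq_card; apply/subsetP => F; rewrite !inE => /andP[/andP[Ft /eqP F3] eF].
have : #|F :\: e| == 1%N by have := cardsID e F; rewrite (setIidPr eF) F3 e2; lia.
case/cards1P => v ev; apply/imsetP; exists v.
  have : v \in F :\: e by rewrite ev set11.
  by rewrite !inE => /andP[-> /(subsetP Ft)]; rewrite inE.
by rewrite -ev setUC -{1}(setID F e) (setIidPr eF).
Qed.

Lemma manifold_third k (e F G H : {set 'I_n.+4}) : (k <= n)%N -> #|e| = 2%N -> F \in T k -> G \in T k -> H \in T k ->
  e \subset F -> e \subset G -> e \subset H -> F != G -> F != H -> G = H.
Proof.
move=> kn e2 FT GT HT eF eG eH FG FH; apply/eqP; apply: contraT => GH.
have := surf_manifold kn e2; rewrite leqNgt => /negP[].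
apply: (@leq_trans #|F |: [set G; H]|).
  by rewrite cardsU1 cards2 !inE negb_or FG FH GH.
apply: subset_leq_card; apply/subsetP => X; rewrite !inE.
by case/or3P => /eqP->; apply/andP.
Qed.

Lemma surf_noncoplanar k F G : (k <= n)%N -> F \in T k -> G \in T k -> #|F :&: G| = 2%N ->
  affindep p (F :|: G).
Proof.
elim: k F G => [|k IH] F G kn.
  rewrite !inE => /andP[Ft F3] /andP[Gt G3] FG.
  suff -> : F :|: G = tet0 n by apply: (base_affindep card_tet0 ker0).
  apply/eqP; rewrite eqEcard subUset Ft Gt /= card_tet0 cardsU FG.
  by rewrite (eqP F3) (eqP G3).
have kn' := ltnW kn; have fT := f_in kn; have af := apex_notin kn fT.
have f3 := surf_card3 kn' fT.
have fv v : v \in f k -> #|f k :\ v| = 2%N by move/card_rem1; apply.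
(* A new face and an old one share two vertices only along an edge of [f k]; the manifold property
   then identifies the old face with the one given by [nbr]. *)
have mixed v H : v \in f k -> H \in T k :\ f k -> #|(a k |: (f k :\ v)) :&: H| = 2%N ->
    affindep p ((a k |: (f k :\ v)) :|: H).
  move=> vf; rewrite in_setD1 => /andP[Hf HT] c2; have aH := apex_notin kn HT.
  have sub : f k :\ v \subset H.
    have e : (a k |: (f k :\ v)) :&: H = (f k :\ v) :&: H.
      by apply/setP => x; rewrite !inE; have [->|//] := eqVneq x (a k); rewrite (negPf aH) !andbF.
    apply/setIidPl/eqP; rewrite eqEcard subsetIl /= -e c2 fv //.
  have [G0 [d [G0T G0f subG [dG pd sd]]]] := nbr kn vf.
  have eH : G0 = H.
    by apply: (@manifold_third k (f k :\ v) (f k)) => //; rewrite ?fv ?subD1set // eq_sym.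
  have -> : (a k |: (f k :\ v)) :|: H = a k |: H by rewrite -setUA (setUidPr sub).
  by rewrite -eH in HT aH *; apply: fan_affindepU1 (surf_unique kn') HT aH dG pd sd.
rewrite surfS => /setUP[Fo|/imsetP[v vf ->]] /setUP[Go|/imsetP[u uf ->]] FG.
- by apply: IH => //; [move: Fo | move: Go]; rewrite in_setD1 => /andP[].
- by rewrite setUC; apply: mixed => //; rewrite setIC.
- exact: mixed.
have vu : v != u.
  apply: contra_eq_neq FG => ->; rewrite setIid cardsU1 !inE (negPf af) andbF fv //.
suff -> : (a k |: (f k :\ v)) :|: (a k |: (f k :\ u)) = a k |: f k.
  apply: (stellar_tet_affindep (T := T k) (c := c k)) (surf_unique kn') => //.
  - by move=> H; apply: apex_notin.
  - exact: c_out.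
  - exact: p_apex.
  - exact: c_sum.
apply/setP => x; rewrite !inE; case: (x == a k) => //=.
have [->|] := eqVneq x v; last by move=> _ /=; case: (x \in f k) => //=; rewrite andbF.
by rewrite vf vu.
Qed.

(** Old points are pushed through the subdivision and points of the new tetrahedron are expanded;
    neither operation raises the gauge. *)
Lemma solid_rep k x : (k <= n)%N -> solid p f k x -> exists F lam,
  [/\ F \in T k, conic F lam, x = comb p lam & \sum_v lam v <= 1].
Proof.
elim: k x => [|k IH] x kn.
  case=> [[lam [/baryP[cl sl] ->]]|[j]]; last by [].
  have [F [mu [s [FT cm <- e s0]]]] := base_push card_tet0 rel0 (proj2 cl).
  by exists F, mu; split=> //; rewrite e sl lerBlDr lerDl s0 //; case: cl.
have T3 F : F \in T k -> #|F| = 3%N by apply: surf_card3; apply: ltnW.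
have push := stellar_push T3 (f_in kn) (fun F => @apex_notin k F kn) (@c_gt0 k kn) (@c_out k kn) (p_apex kn) (c_sum kn).
have expand := stellar_expand T3 (f_in kn) (fun F => @apex_notin k F kn) (@c_gt0 k kn) (@c_out k kn) (p_apex kn) (c_sum kn).
have old : solid p f k x -> exists F lam,
  [/\ F \in T k.+1, conic F lam, x = comb p lam & \sum_v lam v <= 1].
  move=> /(IH _ (ltnW kn))[F [lam [FT cl -> sl]]].
  have [G [mu [GT cm <- h]]] := push F lam FT cl.
  by exists G, mu; split=> //; apply: le_trans sl.
case=> [h|[j /= jk xj]]; first by apply: old; left.
move: jk; rewrite ltnS leq_eqVlt => /orP[/eqP ej|jk]; last by apply: old; right; exists j.
case: xj => lam [/baryP[cl sl] ->]; rewrite /tet ej in cl.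
have [G [mu [GT cm <- h]]] := expand lam cl.
by exists G, mu; split=> //; rewrite -sl.
Qed.

Theorem fan_stacked : stacked p f.
Proof.
split; first exact: (base_affindep card_tet0 ker0).
split=> k kn.
  have kn' := ltnW kn.
  split; first exact: f_in.
  split.
    apply: (stellar_tet_affindep (T := T k) (c := c k)) (surf_unique kn').
    - exact: f_in.
    - by move=> H; apply: apex_notin.
    - exact: c_out.
    - exact: p_apex.
    - exact: c_sum.
  apply: (stellar_solidI (T := T k) (c := c k)) => //.
  - exact: f_in.
  - by move=> H; apply: apex_notin.
  - exact: c_gt0.
  - exact: c_out.
  - exact: p_apex.
  - exact: c_sum.
  - exact: surf_unique.
  by move=> x; apply: solid_rep.
split=> [F FT|]; first by (split; [apply: surf_card3 FT | apply: fan_affindep (surf_unique kn) FT]).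
split=> F G FT GT; first exact: fan_hullI (surf_unique kn) FT GT.
by move=> c2; apply: (surf_noncoplanar kn FT GT c2).
Qed.

End Stack.

(** * Radial homeomorphism with the sphere *)

Section Homeo.
Variable R : realType.

Lemma continuous_bigsum (U : topologicalType) (V : normedModType R) (I : Type) (r : seq I)
  (F : I -> U -> V) : (forall i, continuous (F i)) -> continuous (fun x => \sum_(i <- r) F i x).
Proof.
move=> cF; elim: r => [|i r IH] x.
  by under eq_fun do rewrite big_nil; exact: cvg_cst.
under eq_fun do rewrite big_cons.
by apply: cvgD; [exact: cF | exact: IH].
Qed.

Lemma compact_hull m k (p : 'I_m -> 'rV[R]_k) (S : {set 'I_m}) : compact (hull p S).
Proof.
pose D : set 'rV[R]_m := [set v | forall i, `[0, 1]%classic (v ord0 i)]%classic.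
pose E : set 'rV[R]_m := [set v | (fun u : 'rV[R]_m => \sum_i u ord0 i) v = 1]%classic.
pose Z : set 'rV[R]_m := (\bigcap_(i in [set i | i \notin S]) [set v : 'rV[R]_m | v ord0 i = 0])%classic.
pose h (v : 'rV[R]_m) := \sum_i v ord0 i *: p i.
have cD : compact D.
  by apply: (@rV_compact R m (fun=> `[0, 1]%classic)) => i; exact: segment_compact.
have cE : closed E.
  have c : continuous (fun u : 'rV[R]_m => \sum_i u ord0 i).
    apply: (@continuous_bigsum _ R 'I_m _ (fun i (u : 'rV[R]_m) => u ord0 i)) => i.
    exact: coord_continuous.
  by apply: (@preimage_closed 'rV[R]_m R (fun u : 'rV[R]_m => \sum_i u ord0 i) [set x : R | x = 1]%classic) => [x _|]; [exact: c | exact: closed_eq].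
have cZ : closed Z.
  apply: closed_bigI => i _.
  apply: (@preimage_closed 'rV[R]_m R (fun v : 'rV[R]_m => v ord0 i) [set x : R | x = 0]%classic) => [x _|].
    exact: coord_continuous.
  exact: closed_eq.
have -> : hull p S = (h @` (D `&` (E `&` Z)))%classic.
  rewrite classical_sets.eqEsubset; split=> [x [lam [/baryP[[l0 lS] sl] ->]]|x [v [vD [vE vZ]] <-]].
    exists (\row_i lam i); last by apply: eq_bigr => i _; rewrite mxE.
    split=> [i|]; last split.
    - rewrite mxE /= in_itv /= l0 -sl (bigD1 i) //= lerDl.
      by apply: sumr_ge0.
    - by rewrite /E /= -[RHS]sl; apply: eq_bigr => i _; rewrite mxE.
    - by move=> i /= iS; rewrite mxE lS.
  exists (fun i => v ord0 i); split=> //; split; last by split=> [i /vZ|].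
  by move=> i; have := vD i; rewrite /= in_itv /= => /andP[].
apply: continuous_compact; last first.
  by apply: compact_closedI => //; exact: closedI.
apply: continuous_subspaceT.
apply: (@continuous_bigsum _ _ 'I_m _ (fun i (u : 'rV[R]_m) => u ord0 i *: p i)) => i x.
by apply: continuousZr_tmp; exact: coord_continuous.
Qed.

Lemma compact_surface m (p : 'I_m -> 'rV[R]_3) T : compact (surface_set p T).
Proof.
have -> : surface_set p T = \big[classical_sets.setU/classical_sets.set0]_(F in T) hull p F.
  by rewrite -bigcup_pred.
by apply: bigsetU_compact => F _; exact: compact_hull.
Qed.

(** The preimage under [g] of a closed set is the image under [f] of a compact set, hence closed in
    a Hausdorff space. *)
Lemma compact_homeomorphic (U V : topologicalType) (A : set U) (B : set V) (f : U -> V) (g : V -> U) :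
  hausdorff_space V -> compact A -> {within A, continuous f}%classic ->
  (forall x, A x -> B (f x)) -> (forall y, B y -> A (g y)) ->
  (forall x, A x -> g (f x) = x) -> (forall y, B y -> f (g y) = y) -> homeomorphic A B.
Proof.
move=> hV cA cf AB BA fK gK; exists f, g; do !split => //.
apply/continuous_closedP => Z cZ; apply/closed_subspaceP.
exists (f @` (A `&` Z))%classic.
  apply: compact_closed => //; apply: continuous_compact; last exact: compact_closedI.
  by apply: continuous_subspaceW cf => x [].
rewrite classical_sets.eqEsubset; split=> y [].
  by case=> x [Ax Zx] <- By; have Zg : Z (g (f x)) by rewrite fK.
by move=> /= Zg By; split=> //; exists (g y); [split=> //; exact: BA | exact: gK].
Qed.

Definition nrm (x : 'rV[R]_3) : R := Num.sqrt (d2 x 0).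

Lemma d2_ge0 k (x y : 'rV[R]_k) : 0 <= d2 x y.
Proof. by apply: sumr_ge0 => i _; exact: sqr_ge0. Qed.

Lemma d2_eq0 k (x y : 'rV[R]_k) : d2 x y = 0 -> x = y.
Proof.
move=> /eqP; rewrite /d2 psumr_eq0 => [/allP h|i _]; last exact: sqr_ge0.
apply/rowP => i; have := h i (mem_index_enum i); rewrite sqrf_eq0 subr_eq0 => /eqP.
by rewrite (ord1 ord0).
Qed.

Lemma d2Z k a (x : 'rV[R]_k) : d2 (a *: x) 0 = a ^+ 2 * d2 x 0.
Proof. by rewrite /d2 mulr_sumr; apply: eq_bigr => i _; rewrite !mxE; ring. Qed.

Lemma nrm_gt0 x : x != 0 -> 0 < nrm x.
Proof.
move=> x0; rewrite sqrtr_gt0 lt_def d2_ge0 andbT.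
by apply: contra x0 => /eqP/d2_eq0/eqP.
Qed.

Lemma continuous_nrm : continuous nrm.
Proof.
have c : continuous (fun x : 'rV[R]_3 => d2 x 0).
  apply: (@continuous_bigsum _ R 'I_3 _ (fun i (x : 'rV[R]_3) => (x 0 i - (0 : 'rV[R]_3) 0 i) ^+ 2)) => i x.
  have cc : {for x, continuous (fun x : 'rV[R]_3 => x 0 i - (0 : 'rV[R]_3) 0 i)}.
    by apply: continuousB; [exact: coord_continuous | exact: cst_continuous].
  exact: (continuousM cc cc).
move=> x; apply: (@continuous_comp _ R R (fun y : 'rV[R]_3 => d2 y 0) Num.sqrt x (c x)).
exact: sqrt_continuous.
Qed.

Lemma fan_homeo m (p : 'I_m -> 'rV[R]_3) T : fan_unique p T -> fan_cover p T ->
  homeomorphic (surface_set p T) (@sphere2 R).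
Proof.
move=> uT cT.
pose K := surface_set p T; pose f (x : 'rV[R]_3) := (nrm x)^-1 *: x.
have K0 x : K x -> x != 0.
  move=> [F /= FT [lam [/baryP[cl sl] ex]]]; apply/negP => /eqP x0.
  have e := fan_indep uT FT (proj2 cl) (etrans (esym ex) x0).
  by move: sl; rewrite big1 // => /eqP; rewrite eq_sym oner_eq0.
have fS x : K x -> sphere2 (f x).
  move=> /K0 x0; rewrite /sphere2 /= /f d2Z exprVn sqr_sqrtr ?d2_ge0 // mulVf //.
  by apply: contra x0 => /eqP/d2_eq0->.
(* Equal directions give proportional barycentric coordinates by uniqueness; both sum to 1, so the
   norms agree. *)
have finj x y : K x -> K y -> f x = f y -> x = y.
  move=> Kx Ky; have nx := nrm_gt0 (K0 _ Kx); have ny := nrm_gt0 (K0 _ Ky).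
  move: Kx Ky => [F /= FT [lam [/baryP[cl sl] ex]]] [G /= GT [mu [/baryP[cm sm] ey]]] e.
  have pos z (S : {set 'I_m}) l : 0 < nrm z -> conic S l -> conic S (fun v => (nrm z)^-1 * l v).
    move=> nz [l0 lS]; split=> v; first by apply: mulr_ge0 => //; rewrite invr_ge0 ltW.
    by move=> /lS->; rewrite mulr0.
  have ec : comb p (fun v => (nrm x)^-1 * lam v) = comb p (fun v => (nrm y)^-1 * mu v).
    by rewrite !combZ -ex -ey.
  have e2 := uT _ _ _ _ FT GT (pos x F lam nx cl) (pos y G mu ny cm) ec.
  have en : (nrm x)^-1 = (nrm y)^-1.
    have : \sum_v (nrm x)^-1 * lam v = \sum_v (nrm y)^-1 * mu v by apply: eq_bigr.
    by rewrite -!mulr_sumr sl sm !mulr1.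
  move: e; rewrite /f en; apply: scalerI; by rewrite invr_eq0 gt_eqF.
have surj y : sphere2 y -> exists x, K x /\ f x = y.
  move=> Sy; have [F [lam [FT [l0 lF] ey]]] := cT y.
  have s0 : 0 < \sum_v lam v.
    rewrite lt_def sumr_ge0 // andbT; apply/negP => /eqP /eqP.
    rewrite psumr_eq0 // => /allP h.
    have e0 : comb p lam = comb p (fun=> 0).
      by apply: eq_comb => v; apply/eqP; apply: h; rewrite mem_index_enum.
    move: Sy; rewrite /sphere2 /= ey e0 comb0 /d2 big1 => [/eqP|i _]; first by rewrite eq_sym oner_eq0.
    by rewrite subrr expr0n.
  pose s := \sum_v lam v; have si : 0 < s^-1 by rewrite invr_gt0.
  exists (s^-1 *: y); split.
    exists F => //; exists (fun v => s^-1 * lam v); split; last by rewrite combZ ey.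
    apply/baryP; split; first split=> v; first by apply: mulr_ge0 => //; exact: ltW.
      by move=> /lF->; rewrite mulr0.
    by rewrite -mulr_sumr mulVf // gt_eqF.
  rewrite /f /nrm d2Z Sy mulr1 sqrtr_sqr gtr0_norm // scalerA mulVf ?scale1r // gt_eqF //.
(* An inverse by choice, with the dummy value 0 off the sphere. *)
pose g y := if pselect (exists x, K x /\ f x = y) is left h then projT1 (cid h) else 0.
have gP y : sphere2 y -> K (g y) /\ f (g y) = y.
  move=> /surj h; rewrite /g; case: pselect => // h'; by case: (cid h').
apply: (@compact_homeomorphic _ _ _ _ f g) => //.
- exact: compact_surface.
- apply: continuous_in_subspaceT => x /set_mem/K0 x0.
  apply: (@continuousZ _ _ _ (fun x => (nrm x)^-1) id); last exact: cvg_id.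
  by apply: continuousV; [rewrite gt_eqF ?nrm_gt0 | exact: continuous_nrm].
- by move=> y /gP[].
- by move=> x Kx; have [Kg eg] := gP _ (fS _ Kx); exact: finj.
- by move=> y /gP[].
Qed.

End Homeo.

(** * Connectivity and number of pieces *)

Section ThreeConnected.
Variables (n : nat) (f : nat -> {set 'I_n.+4}).
Hypothesis f_in : forall k, (k < n)%N -> f k \in surf f k.

Definition covered k (u v : 'I_n.+4) := exists2 F, F \in surf f k & (u \in F) && (v \in F).

(** Gluing destroys no edge: two vertices of [f k] stay together in the new face that omits a third
    one. *)
Lemma coveredS k u v : (k < n)%N -> covered k u v -> covered k.+1 u v.
Proof.
move=> kn [F FT /andP[uF vF]]; have [eF|Ff] := eqVneq F (f k); last first.
  by exists F; rewrite ?uF //= !inE Ff FT.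
have [w wF wuv] : exists2 w, w \in F & w \notin [set u; v].
  apply/subsetPn/negP => /subset_leq_card; rewrite (surf_card3 f_in (ltnW kn) FT) cards2.
  by case: (u != v).
move: wuv; rewrite !inE negb_or => /andP[wu wv].
exists (apex n k |: (f k :\ w)).
  by rewrite inE; apply/orP; right; apply/imsetP; exists w; rewrite -?eF.
by rewrite !inE -eF uF vF ![_ == w]eq_sym wu wv !orbT.
Qed.

Lemma coveredW k l u v : (k <= l <= n)%N -> covered k u v -> covered l u v.
Proof.
move=> /andP[kl ln] c; elim: l kl ln => [|l IH]; first by rewrite leqn0 => /eqP <-.
rewrite leq_eqVlt => /orP[/eqP <- //|kl] ln; apply: coveredS => //; apply: IH => //; exact: ltnW.
Qed.

Lemma sadj_covered u v : u != v -> covered n u v -> sadj (surf f n) u v.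
Proof. by move=> uv [F FT h]; rewrite /sadj uv; apply/existsP; exists F; rewrite FT. Qed.

Lemma apex_covered k v : (k < n)%N -> v \in f k -> covered n (apex n k) v.
Proof.
move=> kn vf; have f3 := surf_card3 f_in (ltnW kn) (f_in kn).
have [w] : exists w, w \in f k :\ v by apply/card_gt0P; rewrite (card_rem1 vf f3).
rewrite !inE => /andP[wv wf]; apply: (@coveredW k.+1); first by rewrite kn leqnn.
exists (apex n k |: (f k :\ w)); last by rewrite !inE eqxx [v == w]eq_sym wv vf orbT.
by rewrite inE; apply/orP; right; apply/imsetP; exists w.
Qed.

Lemma tet0_covered u v : u \in tet0 n -> v \in tet0 n -> covered n u v.
Proof.
move=> ut vt; apply: (@coveredW 0); first by rewrite leqnn.
have [w wt wuv] : exists2 w, w \in tet0 n & w \notin [set u; v].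
  by apply/subsetPn/negP => /subset_leq_card; rewrite card_tet0 cards2; case: (u != v).
move: wuv; rewrite !inE negb_or => /andP[wu wv].
exists (tet0 n :\ w); first by rewrite inE subD1set /= (card_rem1 wt (@card_tet0 n)).
by rewrite !in_setD1 ut vt ![_ == w]eq_sym wu wv.
Qed.

(** Each apex is joined to three older vertices, of which at most two are deleted, so every
    surviving vertex descends to the initial tetrahedron, whose graph is complete. *)
Lemma surf_three_connected : three_connected (sadj (surf f n)).
Proof.
split=> // S S2 u v uS vS.
set e := (X in connect X).
have e_sym : symmetric e.
  move=> a b; rewrite /e /sadj eq_sym [(a \notin S) && _]andbC; congr (_ && _ && _).
  by apply: eq_existsb => F; rewrite [(a \in F) && _]andbC.
have step a b : a \notin S -> b \notin S -> covered n a b -> connect e a b.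
  move=> aS bS c; have [->|ab] := eqVneq a b; first exact: connect0.
  by apply: connect1; rewrite /e sadj_covered //= aS.
have down (w : 'I_n.+4) : w \notin S -> exists t, [/\ t \in tet0 n, t \notin S & connect e w t].
  have [N] := ubnP (w : nat); elim: N w => // N IH w wN wS.
  have [w4|w4] := ltnP w 4; first by exists w; rewrite inE.
  have kn : (w - 4 < n)%N by have := ltn_ord w; lia.
  have ew : w = apex n (w - 4) by apply/ord_inj; rewrite apexE //=; lia.
  have [x xf xS] : exists2 x, x \in f (w - 4) & x \notin S.
    apply/subsetPn/negP => /subset_leq_card.
    by rewrite (surf_card3 f_in (ltnW kn) (f_in kn)) leqNgt ltnS S2.
  have xw : (x < N)%N by have := surf_lt f_in (ltnW kn) (f_in kn) xf; lia.
  have [t [t0 tS xt]] := IH x xw xS; exists t; split=> //; apply: connect_trans xt.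
  by apply: step => //; rewrite ew; apply: apex_covered.
have [t [t0 tS ut]] := down u uS; have [s [s0 sS vs]] := down v vS.
apply: connect_trans ut _; rewrite (sym_connect_sym e_sym).
apply: connect_trans vs _; apply: step => //; exact: tet0_covered.
Qed.

End ThreeConnected.

(** * A degree bound for the number of components of a graph *)

Section Components.
Variables (V : finType) (e : rel V) (A : {set V}).
Hypothesis e_sym : symmetric e.
Hypothesis eA : forall x y, e x y -> x \in A.

Let cls x := [set y in A | connect e x y].

Lemma reachable x : exists k, exists2 q, path e (fingraph.root e x) q &
  (last (fingraph.root e x) q == x) && (size q == k).
Proof.
have /connectP[q pq eq] : connect e (fingraph.root e x) x.
  by rewrite (sym_connect_sym e_sym) connect_root.
exists (size q), q; first exact: pq.
by apply/andP; split; apply/eqP.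
Qed.

(** [d] is the length of a shortest path from the canonical root of the component; the last vertex
    but one on such a path is closer. *)
Lemma distance_to_root : exists d : V -> nat, forall x, x != fingraph.root e x ->
  exists2 y, e x y & (d y < d x)%N.
Proof.
pose R x k := `[< exists2 q, path e (fingraph.root e x) q &
  (last (fingraph.root e x) q == x) && (size q == k) >].
have exR x : exists k, R x k by have [k hk] := reachable x; exists k; apply/asboolP.
exists (fun x => ex_minn (exR x)) => x xr.
case: (ex_minnP (exR x)) => k /asboolP[q pq /andP[/eqP lq /eqP sq]] _.
case/lastP: q => [|q z] in pq lq sq *; first by case/eqP: xr; exact: esym lq.
move: pq lq sq; rewrite rcons_path last_rcons size_rcons => /andP[pq eyz] zx <-.
set y := last _ q in eyz; rewrite zx in eyz.
have ryx : fingraph.root e y = fingraph.root e x.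
  by apply/(fingraph.rootP (sym_connect_sym e_sym)); apply: connect1.
exists y; first by rewrite e_sym.
case: (ex_minnP (exR y)) => l _; apply; apply/asboolP; exists q; rewrite ryx //.
by rewrite !eqxx.
Qed.

(* Edges from each non-root vertex to a vertex closer to the root, counted twice. *)
Lemma components_degree :
  (2 * #|A| <= 2 * #|[set cls x | x in A]| + \sum_(x in A) #|[set y | e x y]|)%N.
Proof.
have [d dP] := distance_to_root.
pose par x := odflt x [pick y | e x y && (d y < d x)%N].
have parP x : x != fingraph.root e x -> e x (par x) && (d (par x) < d x)%N.
  move=> /dP[y xy dy]; rewrite /par; case: pickP => [//|/(_ y)]; by rewrite xy dy.
pose B := [set x in A | x != fingraph.root e x].
have cA : #|A| = (#|A :\: B| + #|B|)%N.
  by rewrite -(cardsID B A) addnC (setIidPr _) //; apply/subsetP => x; rewrite inE => /andP[].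
have cC : (#|A :\: B| <= #|[set cls x | x in A]|)%N.
  rewrite -(card_in_imset (f := cls) (D := A :\: B)).
    by apply/subset_leq_card/imsetS/subsetDl.
  move=> x y; rewrite !inE => /andP[xB xA] /andP[yB yA] exy.
  move: xB yB; rewrite xA yA /= !negbK => /eqP xr /eqP yr.
  rewrite xr yr; apply/(fingraph.rootP (sym_connect_sym e_sym)).
  have : y \in cls x by rewrite exy inE yA connect0.
  by rewrite inE => /andP[].
pose P := [set z : V * V | (z.1 \in A) && e z.1 z.2].
have -> : (\sum_(x in A) #|[set y | e x y]| = #|P|)%N.
  rewrite -sum1_card (eq_bigl (fun z : V * V => (z.1 \in A) && e z.1 z.2)) => [|z]; last by rewrite inE.
  rewrite -(pair_big_dep (fun x => x \in A) (fun x y => e x y) (fun _ _ => 1%N)) /=.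
  by apply: eq_bigr => x _; rewrite -sum1_card; apply: eq_bigl => y; rewrite inE.
pose P1 := [set (x, par x) | x in B]; pose P2 := [set (par x, x) | x in B].
have c1 : #|P1| = #|B| by apply: card_imset => x y [].
have c2 : #|P2| = #|B| by apply: card_imset => x y [].
(* A pair in both sets would have two vertices each strictly closer to the root than the other. *)
have dis : [disjoint P1 & P2].
  rewrite disjoint_subset; apply/subsetP => z /imsetP[x xB ->]; rewrite inE.
  apply/imsetP => -[y yB [exy eyx]].
  move: xB yB; rewrite !inE => /andP[_ /parP/andP[_ h1]] /andP[_ /parP/andP[_ h2]].
  by move: h1 h2; rewrite eyx -exy => h1 /(ltn_trans h1); rewrite ltnn.
have : (#|P1 :|: P2| <= #|P|)%N.
  apply: subset_leq_card; apply/subsetP => z; rewrite !inE => /orP[] /imsetP[x xB ->] /=.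
    by move: xB; rewrite inE => /andP[-> /parP/andP[->]].
  move: xB; rewrite inE => /andP[xA /parP/andP[h _]].
  by rewrite e_sym h andbT; apply: (eA (y := x)); rewrite e_sym.
have -> : #|P1 :|: P2| = (#|B| + #|B|)%N.
  by move: dis; rewrite -leq_card_setU => /eqP ->; rewrite c1 c2.
rewrite cA; lia.
Qed.

End Components.

(** * Angles in planar layouts *)

Section Planar.
Variable R : realType.
Implicit Types (x y : R).

(** Cross products of opposite sign put the outer vectors on the same side of the middle one, so the
    two wedges share interior rays. *)
Lemma same_side x0 y0 x1 y1 x2 y2 : let k1 := x0 * y1 - y0 * x1 in let k2 := x1 * y2 - y1 * x2 in
  k1 * k2 < 0 -> exists a b c d : R, [/\ 0 <= a, 0 < b, 0 <= c & 0 < d] /\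
  (a * x1 + b * x0 = c * x1 + d * x2 /\ a * y1 + b * y0 = c * y1 + d * y2).
Proof.
move=> k1 k2 k12.
have [k1n k2n] : k1 != 0 /\ k2 != 0.
  by split; apply: contraTneq k12 => ->; rewrite (mul0r, mulr0) ltxx.
(* These weights give the outer vectors equal height over the line of the middle one. They then
   differ by [t] times the middle vector, and the sign of [t] decides on which side that multiple is
   placed. *)
pose b := `|k2|; pose d := `|k1|.
have l1 : x1 ^+ 2 + y1 ^+ 2 != 0.
  apply: contra k1n; rewrite paddr_eq0 ?sqr_ge0 // !sqrf_eq0 => /andP[/eqP hx /eqP hy].
  by rewrite /k1 hx hy !mulr0 subrr.
have bd : b * k1 + d * k2 = 0.
  rewrite /b /d; case: (ltrgt0P k1) k12 k1n => // h1; case: (ltrgt0P k2) k2n => // h2 _ k12 _; nra.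
pose t := (b * (x0 * x1 + y0 * y1) - d * (x2 * x1 + y2 * y1)) / (x1 ^+ 2 + y1 ^+ 2).
have tx : b * x0 - d * x2 = t * x1.
  rewrite /t mulrAC -[LHS](mulfK l1); congr (_ / _).
  have : y1 * (b * k1 + d * k2) = 0 by rewrite bd mulr0.
  by rewrite /k1 /k2 => h; apply: subr0_eq; rewrite -[RHS]h; ring.
have ty : b * y0 - d * y2 = t * y1.
  rewrite /t mulrAC -[LHS](mulfK l1); congr (_ / _).
  have : - x1 * (b * k1 + d * k2) = 0 by rewrite bd mulr0.
  by rewrite /k1 /k2 => h; apply: subr0_eq; rewrite -[RHS]h; ring.
exists (Num.max (- t) 0), b, (Num.max t 0), d; split.
  by split; rewrite ?le_max ?lexx ?orbT // normr_gt0.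
have [h|h] := leP t 0; [rewrite max_l ?oppr_ge0 //|rewrite max_r ?oppr_le0 ?(ltW h) //];
  rewrite ?(max_l (ltW h)); split; lra.
Qed.

(* The hypotheses force the three wedge angles h1, h2, h3 to satisfy h1 + h2 + h3 > 2 pi.
   In the proof [X] and [Y] are proportional to cos (h2 + h3) and - sin (h2 + h3). *)
Lemma wrap_around s x0 y0 x1 y1 x2 y2 x3 y3 eta :
  let k1 := x0 * y1 - y0 * x1 in let k2 := x1 * y2 - y1 * x2 in let k3 := x2 * y3 - y2 * x3 in
  let l0 := x0 ^+ 2 + y0 ^+ 2 in let l1 := x1 ^+ 2 + y1 ^+ 2 in
  let l2 := x2 ^+ 2 + y2 ^+ 2 in let l3 := x3 ^+ 2 + y3 ^+ 2 in
  let d1 := x0 * x1 + y0 * y1 in let d2 := x1 * x2 + y1 * y2 in let d3 := x2 * x3 + y2 * y3 in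
  0 < s * k1 -> 0 < s * k2 -> 0 < s * k3 -> s ^+ 2 = 1 -> 1 / 2 < eta -> eta <= 1 ->
  d2 < 0 -> eta * (l1 * l2) <= d2 ^+ 2 -> d3 < 0 -> eta * (l2 * l3) <= d3 ^+ 2 ->
  d1 <= 0 \/ d1 ^+ 2 < (2 * eta - 1) ^+ 2 * (l0 * l1) ->
  exists a b c d : R, [/\ 0 <= a, 0 < b, 0 <= c & 0 <= d] /\
  (a * x1 + b * x0 = c * x2 + d * x3 /\ a * y1 + b * y0 = c * y2 + d * y3).
Proof.
move=> k1 k2 k3 l0 l1 l2 l3 d1 d2 d3 sk1 sk2 sk3 s2 eta1 eta2 d2n hd2 d3n hd3 hd1.
have l0p : 0 <= l0 by rewrite addr_ge0 ?sqr_ge0.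
have l1p : 0 < l1.
  rewrite lt_def addr_ge0 ?sqr_ge0 // andbT; apply: contraTneq d2n => /eqP.
  rewrite paddr_eq0 ?sqr_ge0 // !sqrf_eq0 => /andP[/eqP hx /eqP hy].
  by rewrite /d2 hx hy !mul0r addr0 ltxx.
have l2p : 0 < l2.
  rewrite lt_def addr_ge0 ?sqr_ge0 // andbT; apply: contraTneq d2n => /eqP.
  rewrite paddr_eq0 ?sqr_ge0 // !sqrf_eq0 => /andP[/eqP hx /eqP hy].
  by rewrite /d2 hx hy !mulr0 addr0 ltxx.
have l3p : 0 < l3.
  rewrite lt_def addr_ge0 ?sqr_ge0 // andbT; apply: contraTneq d3n => /eqP.
  rewrite paddr_eq0 ?sqr_ge0 // !sqrf_eq0 => /andP[/eqP hx /eqP hy].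
  by rewrite /d3 hx hy !mulr0 addr0 ltxx.
pose X := d2 * d3 - k2 * k3; pose Y := - (s * k2 * d3 + d2 * (s * k3)).
have Yp : 0 < Y by rewrite /Y; nra.
have q2 : k2 ^+ 2 + d2 ^+ 2 = l1 * l2 by rewrite /k2 /d2 /l1 /l2; ring.
have q3 : k3 ^+ 2 + d3 ^+ 2 = l2 * l3 by rewrite /k3 /d3 /l2 /l3; ring.
have q1 : k1 ^+ 2 + d1 ^+ 2 = l0 * l1 by rewrite /k1 /d1 /l0 /l1; ring.
pose Q := (l1 * l2) * (l2 * l3).
have Qp : 0 < Q by rewrite !mulr_gt0.
pose r := Num.sqrt Q.
have rp : 0 < r by rewrite sqrtr_gt0.
have rQ : r ^+ 2 = Q by rewrite sqr_sqrtr // ltW.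
have dd : eta * r <= d2 * d3.
  rewrite -(ler_pXn2r (n := 2)) ?nnegrE //; last 2 first.
  - by rewrite mulr_ge0 // ?ltW //; lra.
  - by rewrite ltW // nmulr_rgt0.
  rewrite !exprMn rQ /Q.
  have : (eta * (l1 * l2)) * (eta * (l2 * l3)) <= d2 ^+ 2 * d3 ^+ 2.
    by apply: ler_pM => //; rewrite !mulr_ge0 // ?ltW //; lra.
  by move=> h; apply: le_trans h; rewrite le_eqVlt; apply/orP; left; apply/eqP; ring.
have kk : k2 * k3 <= (1 - eta) * r.
  have kp : 0 < k2 * k3.
    have -> : k2 * k3 = (s * k2) * (s * k3) by rewrite -[LHS]mul1r -s2; ring.
    exact: mulr_gt0.
  rewrite -(ler_pXn2r (n := 2)) ?nnegrE //; last 2 first.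
  - exact: ltW.
  - by apply: mulr_ge0; [lra | exact: ltW].
  rewrite !exprMn rQ /Q.
  have : k2 ^+ 2 * k3 ^+ 2 <= ((1 - eta) * (l1 * l2)) * ((1 - eta) * (l2 * l3)).
    by apply: ler_pM; rewrite ?sqr_ge0 //; lra.
  by move=> h; apply: (le_trans h); rewrite le_eqVlt; apply/orP; left; apply/eqP; ring.
(* This is cos (h2 + h3) >= eta - (1 - eta), the origin of the threshold [2 * eta - 1] for the
   cosine of h1. *)
have Xr : (2 * eta - 1) * r <= X by rewrite /X; lra.
have Xp : 0 < X by apply: lt_le_trans Xr; rewrite mulr_gt0 //; lra.
have XY : X ^+ 2 + Y ^+ 2 = Q.
  rewrite /Q -q2 -q3 /X /Y.
  have -> : (- (s * k2 * d3 + d2 * (s * k3))) ^+ 2 = s ^+ 2 * (k2 * d3 + d2 * k3) ^+ 2 by ring.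
  by rewrite s2; ring.
(* Up to a positive factor, the left-hand quantity is sin (h1 + h2 + h3). *)
have main : 0 < s * k1 * X - d1 * Y.
  case: (lerP d1 0) => [d1n|d1p]; first by have := mulr_gt0 sk1 Xp; nra.
  case: hd1 => [|hd1]; first by rewrite leNgt d1p.
  rewrite subr_gt0 -(ltr_pXn2r (n := 2)) ?nnegrE //; last 2 first.
  - by apply: mulr_ge0; apply: ltW.
  - by apply: mulr_ge0; apply: ltW.
  rewrite !exprMn s2 mul1r.
  have -> : k1 ^+ 2 = l0 * l1 - d1 ^+ 2 by rewrite -q1; ring.
  have -> : Y ^+ 2 = Q - X ^+ 2 by rewrite -XY; ring.
  rewrite mulrBl mulrBr ltrD2r.
  apply: (@lt_le_trans _ _ ((2 * eta - 1) ^+ 2 * (l0 * l1) * Q)); first by rewrite ltr_pM2r.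
  rewrite -rQ mulrAC mulrC ler_wpM2l //; first by rewrite mulr_ge0 // ltW.
  rewrite -exprMn ler_pXn2r ?nnegrE //; [by apply: mulr_ge0; [lra | exact: ltW] | exact: ltW].
have ll : 0 < l1 * l2 by exact: mulr_gt0.
(* In the plane, (r0 x r3) r1 + (r3 x r1) r0 = (r0 x r1) r3. All three cross products get the same
   sign, so the last ray has come back into the first wedge. *)
pose z := s * (x0 * y3 - y0 * x3); pose w := s * (x3 * y1 - y3 * x1).
have zp : 0 < z.
  rewrite -(pmulr_lgt0 _ ll); apply: lt_le_trans main _; rewrite le_eqVlt; apply/orP; left; apply/eqP.
  rewrite /z /X /Y /k1 /k2 /k3 /d1 /d2 /d3 /l1 /l2; ring.
have wp : 0 < w.
  rewrite -(pmulr_lgt0 _ l2p); apply: lt_le_trans Yp _; rewrite le_eqVlt; apply/orP; left; apply/eqP.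
  rewrite /w /Y /k2 /k3 /d2 /d3 /l2; ring.
exists z, w, 0, (s * k1); split; first by split=> //; apply: ltW.
by rewrite /z /w /k1; split; ring.
Qed.

(** If consecutive cross products change sign, the layout folds back along the shared ray; otherwise
    all three wedges turn the same way and sweep more than 2 pi. The strict sign of [b] is what
    later contradicts injectivity. *)
Lemma planar_overlap x0 y0 x1 y1 x2 y2 x3 y3 eta :
  let k1 := x0 * y1 - y0 * x1 in let k2 := x1 * y2 - y1 * x2 in let k3 := x2 * y3 - y2 * x3 in
  let l0 := x0 ^+ 2 + y0 ^+ 2 in let l1 := x1 ^+ 2 + y1 ^+ 2 in
  let l2 := x2 ^+ 2 + y2 ^+ 2 in let l3 := x3 ^+ 2 + y3 ^+ 2 in
  let d1 := x0 * x1 + y0 * y1 in let d2 := x1 * x2 + y1 * y2 in let d3 := x2 * x3 + y2 * y3 in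
  k1 != 0 -> k2 != 0 -> k3 != 0 -> 1 / 2 < eta -> eta <= 1 ->
  d2 < 0 -> eta * (l1 * l2) <= d2 ^+ 2 -> d3 < 0 -> eta * (l2 * l3) <= d3 ^+ 2 ->
  d1 <= 0 \/ d1 ^+ 2 < (2 * eta - 1) ^+ 2 * (l0 * l1) ->
  exists a b c d : R, [/\ 0 <= a, 0 < b, 0 <= c & 0 <= d] /\
  [\/ (a * x1 + b * x0 = c * x1 + d * x2 /\ a * y1 + b * y0 = c * y1 + d * y2),
      (a * x2 + b * x1 = c * x2 + d * x3 /\ a * y2 + b * y1 = c * y2 + d * y3) |
      (a * x1 + b * x0 = c * x2 + d * x3 /\ a * y1 + b * y0 = c * y2 + d * y3)].
Proof.
move=> k1 k2 k3 l0 l1 l2 l3 d1 d2 d3 n1 n2 n3 eta1 eta2 d2n hd2 d3n hd3 hd1.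
have [k12|k12] := ltP (k1 * k2) 0.
  have [a [b [c [d [[a0 b0 c0 d0] h]]]]] := same_side k12.
  by exists a, b, c, d; split; [split=> //; exact: ltW | constructor 1].
have [k23|k23] := ltP (k2 * k3) 0.
  have [a [b [c [d [[a0 b0 c0 d0] h]]]]] := same_side k23.
  by exists a, b, c, d; split; [split=> //; exact: ltW | constructor 2].
suff [s [s1 s2 s3 ss]] : exists s, [/\ 0 < s * k1, 0 < s * k2, 0 < s * k3 & s ^+ 2 = 1].
  have [a [b [c [d [h0 h]]]]] := wrap_around s1 s2 s3 ss eta1 eta2 d2n hd2 d3n hd3 hd1.
  by exists a, b, c, d; split=> //; constructor 3.
case: (ltrgt0P k2) n2 => // h2 _; [exists 1 | exists (-1)]; rewrite ?sqrrN expr1n ?mulN1r ?mul1r ?oppr_gt0;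
  split=> //; rewrite lt_def ?n1 ?n3 ?[0 == _]eq_sym ?n1 ?n3 /=.
- by rewrite pmulr_lge0 in k12.
- by rewrite pmulr_rge0 in k23.
- by rewrite nmulr_lge0 in k12.
- by rewrite nmulr_rge0 in k23.
Qed.

End Planar.

Section Dot.
Variables (R : realType) (m k : nat).
Implicit Types (q : 'I_m -> 'rV[R]_k) (v a b c : 'I_m).

Definition dotv q v a b : R := \sum_i (q a 0 i - q v 0 i) * (q b 0 i - q v 0 i).

Lemma dotvC q v a b : dotv q v a b = dotv q v b a.
Proof. by apply: eq_bigr => i _; rewrite mulrC. Qed.

Lemma dotv_polar q v a b : 2 * dotv q v a b = d2 (q a) (q v) + d2 (q b) (q v) - d2 (q a) (q b).
Proof.
rewrite /dotv /d2 mulr_sumr -big_split -sumrB /=; apply: eq_bigr => i _; ring.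
Qed.

Lemma dotv_quad q v a b c x y z :
  \sum_i (x * (q a 0 i - q v 0 i) + y * (q b 0 i - q v 0 i) + z * (q c 0 i - q v 0 i)) ^+ 2 =
  x ^+ 2 * dotv q v a a + y ^+ 2 * dotv q v b b + z ^+ 2 * dotv q v c c +
  2 * (x * y * dotv q v a b + x * z * dotv q v a c + y * z * dotv q v b c).
Proof.
rewrite /dotv !mulr_sumr -!big_split /= mulr_sumr -!big_split /=.
by apply: eq_bigr => i _; ring.
Qed.

Definition bump v a (u : 'I_m) : R := (u == a)%:R - (u == v)%:R.

Lemma comb_bump q v a : comb q (bump v a) = q a - q v.
Proof. by rewrite combB !comb_delta. Qed.

Lemma sum_bump v a : \sum_u bump v a u = 0.
Proof.
have s1 w : \sum_u (u == w)%:R = 1 :> R.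
  by rewrite (bigD1 w) //= eqxx big1 ?addr0 // => u /negPf ->.
by rewrite sumB !s1 subrr.
Qed.

Lemma affindep_quad q v a b c x y z (S : {set 'I_m}) : affindep q S ->
  uniq [:: v; a; b; c] -> v \in S -> a \in S -> b \in S -> (c \in S) || (z == 0) ->
  x ^+ 2 * dotv q v a a + y ^+ 2 * dotv q v b b + z ^+ 2 * dotv q v c c +
  2 * (x * y * dotv q v a b + x * z * dotv q v a c + y * z * dotv q v b c) = 0 ->
  [/\ x = 0, y = 0 & z = 0].
Proof.
move=> aS; rewrite /= !inE !negb_or => /andP[/and3P[va vb vc] /andP[/andP[ab ac] /andP[bc _]]] vS aS' bS cS.
rewrite -dotv_quad => /eqP; rewrite psumr_eq0 => [/allP h|i _]; last exact: sqr_ge0.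
pose lam u := 0 + x * bump v a u + y * bump v b u + z * bump v c u.
have cl : comb q lam = 0.
  rewrite !combD !comb_bump comb0 add0r; apply/rowP => i; rewrite !mxE.
  by have /= := h i (mem_index_enum i); rewrite sqrf_eq0 => /eqP.
have sl : \sum_u lam u = 0.
  by rewrite !big_split /= -!mulr_sumr !sum_bump big1 // !mulr0 !addr0.
have l0 : forall u, lam u = 0.
  apply: aS => // u uS; rewrite /lam /bump.
  have ne w : w \in S -> (u == w) = false by move=> wS; apply: contraNF uS => /eqP->.
  rewrite (ne v) // (ne a) // (ne b) //=; case/orP: cS => [cS|/eqP->]; last by ring.
  by rewrite (ne c) //=; ring.
have val w : lam w = 0 + x * bump v a w + y * bump v b w + z * bump v c w by [].
split.
- have := val a; rewrite l0 /bump eqxx (negPf ab) (negPf ac) [a == v]eq_sym (negPf va) /=; lra.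
- have := val b; rewrite l0 /bump eqxx [b == a]eq_sym (negPf ab) (negPf bc) [b == v]eq_sym (negPf vb) /=; lra.
have := val c; rewrite l0 /bump eqxx [c == a]eq_sym (negPf ac) [c == b]eq_sym (negPf bc) [c == v]eq_sym (negPf vc) /=; lra.
Qed.

End Dot.

Lemma dotv_plane (R : realType) m (q : 'I_m -> 'rV[R]_2) v a b :
  dotv q v a b = (q a 0 0 - q v 0 0) * (q b 0 0 - q v 0 0) + (q a 0 1 - q v 0 1) * (q b 0 1 - q v 0 1).
Proof.
rewrite /dotv big_ord_recl big_ord1.
by have -> : lift ord0 ord0 = 1 :> 'I_2 by apply/val_inj.
Qed.

(** * Obstructions to laying out consecutive faces around a vertex *)

Section Layout.
Variables (R : realType) (m : nat) (p : 'I_m -> 'rV[R]_3) (T C : {set {set 'I_m}}).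
Hypothesis uT : fan_unique p T.
Implicit Types (F G : {set 'I_m}) (v a b c t : 'I_m).

Section Piece.
Variables (P : {set {set 'I_m}}) (L : {set 'I_m} -> 'I_m -> 'rV[R]_2).
Hypothesis PT : P \subset T.
Hypothesis gl : good_layout p T C P L.

Lemma layout_dotv F v a b : F \in P -> v \in F -> a \in F -> b \in F ->
  dotv (L F) v a b = dotv p v a b.
Proof.
move=> FP vF aF bF; have [iso _] := gl.
apply: (mulfI (x := 2)); first by rewrite pnatr_eq0.
by rewrite !dotv_polar !iso.
Qed.

Lemma layout_glue F G v : F \in P -> G \in P -> fadj T C F G -> v \in F -> v \in G -> L F v = L G v.
Proof. by move=> FP GP FG vF vG; have [_ [h _]] := gl; apply: h => //; rewrite inE vF vG. Qed.

Definition wedge v a b (x y : R) u : R := (u == v)%:R + x * bump R v a u + y * bump R v b u.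

Lemma wedge_bary v a b x y : v != a -> v != b -> 0 <= x -> 0 <= y -> x + y <= 1 ->
  bary [set v; a; b] (wedge v a b x y).
Proof.
move=> va vb x0 y0 xy; split=> [u|]; last split=> [u|].
- rewrite /wedge /bump; have [->|uv] := eqVneq u v.
    by rewrite (negPf va) (negPf vb) /=; lra.
  by case: (u == a); case: (u == b) => /=; lra.
- rewrite !inE !negb_or => /andP[/andP[uv ua] ub].
  by rewrite /wedge /bump (negPf uv) (negPf ua) (negPf ub) /=; ring.
rewrite !big_split /= -!mulr_sumr !sum_bump !mulr0 !addr0.
by rewrite (bigD1 v) //= eqxx big1 ?addr0 // => u /negPf ->.
Qed.

Lemma comb_wedge k (q : 'I_m -> 'rV[R]_k) v a b x y :
  comb q (wedge v a b x y) = q v + x *: (q a - q v) + y *: (q b - q v).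
Proof. by rewrite !combD !comb_bump comb_delta. Qed.

(* The equation can be rescaled so that both sides stay inside the two faces, where the
   layout is injective. *)
Lemma layout_wedge v a b c d x y z w :
  let F := [set v; a; b] in let G := [set v; c; d] in
  F \in P -> G \in P -> L F v = L G v -> uniq [:: v; a; b] -> v != c -> v != d -> b \notin [:: c; d] ->
  0 <= x -> 0 <= y -> 0 <= z -> 0 <= w ->
  (forall i, x * (L F a 0 i - L F v 0 i) + y * (L F b 0 i - L F v 0 i) =
     z * (L G c 0 i - L G v 0 i) + w * (L G d 0 i - L G v 0 i)) ->
  y = 0.
Proof.
move=> F G FP GP Lv; rewrite /= !inE !negb_or => /andP[/andP[va vb] /andP[ab _]] vc vd /andP[bc bd] x0 y0 z0 w0 e.
pose s := 1 + x + y + z + w; have s0 : 0 < s by rewrite /s; lra.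
pose h (r : R) := r / s; have h0 r : 0 <= r -> 0 <= h r by move=> r0; rewrite divr_ge0 // ltW.
have hs r r' : r + r' <= s -> h r + h r' <= 1 by rewrite /h -mulrDl ler_pdivrMr // mul1r.
have [_ [_ [ov _]]] := gl.
have bF : bary F (wedge v a b (h x) (h y)) by apply: wedge_bary => //; [exact: h0|exact: h0|apply: hs; rewrite /s; lra].
have bG : bary G (wedge v c d (h z) (h w)) by apply: wedge_bary => //; [exact: h0|exact: h0|apply: hs; rewrite /s; lra].
have eL : comb (L F) (wedge v a b (h x) (h y)) = comb (L G) (wedge v c d (h z) (h w)).
  rewrite !comb_wedge Lv -!addrA; congr (_ + _); apply/rowP => i; have := e i.
  by rewrite -Lv !mxE /h !(mulrAC _ s^-1) -!mulrDl => ->.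
have [ep _] := ov F G FP GP _ _ bF bG eL.
have /(_ b) := uT (subsetP PT _ FP) (subsetP PT _ GP) (proj1 (iffLR (baryP _ _) bF)) (proj1 (iffLR (baryP _ _) bG)) ep.
rewrite /wedge /bump eqxx [b == v]eq_sym (negPf vb) [b == a]eq_sym (negPf ab) (negPf bc) (negPf bd) /=.
move=> h1; have : h y = 0 by lra.
by move/eqP; rewrite mulf_eq0 invr_eq0 (gt_eqF s0) orbF => /eqP.
Qed.

Lemma layout_cross v a b : [set v; a; b] \in P -> uniq [:: v; a; b] ->
  let F := [set v; a; b] in
  (L F a 0 0 - L F v 0 0) * (L F b 0 1 - L F v 0 1) -
  (L F a 0 1 - L F v 0 1) * (L F b 0 0 - L F v 0 0) != 0.
Proof.
set F := [set v; a; b] => FP; rewrite /= !inE !negb_or => /andP[/andP[va vb] /andP[ab _]].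
apply/negP => /eqP cr.
have vF : v \in F by rewrite !inE eqxx.
have aF : a \in F by rewrite !inE eqxx orbT.
have bF : b \in F by rewrite !inE eqxx !orbT.
have ind := fan_indep uT (subsetP PT _ FP).
have quad (x y : R) : \sum_i (x * (p a 0 i - p v 0 i) + y * (p b 0 i - p v 0 i)) ^+ 2 = 0 -> x = 0 /\ y = 0.
  move=> /eqP; rewrite psumr_eq0 => [/allP h|i _]; last exact: sqr_ge0.
  have cl : comb p (fun u => 0 + x * bump R v a u + y * bump R v b u) = 0.
    rewrite !combD !comb_bump comb0 add0r; apply/rowP => i; rewrite !mxE.
    by have /= := h i (mem_index_enum i); rewrite sqrf_eq0 => /eqP.
  have l0 := ind (fun u => 0 + x * bump R v a u + y * bump R v b u) _ cl.
  have {}l0 u : 0 + x * bump R v a u + y * bump R v b u = 0.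
    apply: l0 => {}u uF; rewrite /bump.
    have ne w : w \in F -> (u == w) = false by move=> wF; apply: contraNF uF => /eqP->.
    by rewrite !ne //=; ring.
  split.
    have := l0 a; rewrite /bump eqxx (negPf ab) [a == v]eq_sym (negPf va) /=; lra.
  have := l0 b; rewrite /bump eqxx [b == a]eq_sym (negPf ab) [b == v]eq_sym (negPf vb) /=; lra.
have quad2 (x y : R) : x ^+ 2 * dotv p v a a + y ^+ 2 * dotv p v b b + 2 * (x * y * dotv p v a b) = 0 -> x = 0 /\ y = 0.
  move=> e; apply: quad; rewrite -[RHS]e /dotv !mulr_sumr -!big_split /= .
  by apply: eq_bigr => i _; ring.
(* With these two coefficients the Gram form equals the squared length of the second edge times the
   squared cross product, which is 0. *)
have [lb _] : dotv p v b b = 0 /\ - dotv p v a b = 0.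
  apply: quad2; rewrite -!(layout_dotv FP) // !dotv_plane.
  set x0 := L F a 0 0 - _ in cr *; set y0 := L F a 0 1 - _ in cr *.
  set x1 := L F b 0 0 - _ in cr *; set y1 := L F b 0 1 - _ in cr *.
  transitivity ((x1 * x1 + y1 * y1) * (x0 * y1 - y0 * x1) ^+ 2); first by ring.
  by rewrite cr expr0n mulr0.
have [_ /eqP] : 0 = 0 :> R /\ 1 = 0 :> R by apply: quad2; rewrite lb; ring.
by rewrite oner_eq0.
Qed.

(** An angle beyond a right angle with squared cosine at least [eta], written without roots. *)
Definition obtuse v a b (eta : R) := dotv p v a b < 0 /\
  eta * (dotv p v a a * dotv p v b b) <= dotv p v a b ^+ 2.

Lemma obtuseC v a b eta : obtuse v a b eta -> obtuse v b a eta.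
Proof. by move=> [h1 h2]; split; rewrite (dotvC p v b a) // [dotv p v b b * _]mulrC. Qed.

(** For [eta] above 1/2, the angle is larger than 2 pi minus the sum of any two [obtuse] angles. *)
Definition wide v a b (eta : R) := dotv p v a b <= 0 \/
  dotv p v a b ^+ 2 < (2 * eta - 1) ^+ 2 * (dotv p v a a * dotv p v b b).

Lemma layout_corner v r0 r1 r2 r3 eta : uniq [:: v; r0; r1; r2; r3] ->
  let F1 := [set v; r0; r1] in let F2 := [set v; r1; r2] in let F3 := [set v; r2; r3] in
  F1 \in P -> F2 \in P -> F3 \in P -> fadj T C F1 F2 -> fadj T C F2 F3 ->
  1 / 2 < eta -> eta <= 1 -> obtuse v r1 r2 eta -> obtuse v r2 r3 eta -> wide v r0 r1 eta -> False.
Proof.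
move=> U F1 F2 F3 F1P F2P F3P a12 a23 e1 e2 [n2 h2] [n3 h3] h1.
have m1 : [/\ v \in F1, r0 \in F1 & r1 \in F1] by rewrite !inE !eqxx !orbT.
have m2 : [/\ v \in F2, r1 \in F2 & r2 \in F2] by rewrite !inE !eqxx !orbT.
have m3 : [/\ v \in F3, r2 \in F3 & r3 \in F3] by rewrite !inE !eqxx !orbT.
case: m1 m2 m3 => v1 r01 r11 [v2 r12 r22] [v3 r23 r33].
have Lv12 := layout_glue F1P F2P a12 v1 v2; have Lv23 := layout_glue F2P F3P a23 v2 v3.
have L1 := layout_glue F1P F2P a12 r11 r12; have L2 := layout_glue F2P F3P a23 r22 r23.
move: U; rewrite /= !inE !negb_or => /andP[/and4P[vr0 vr1 vr2 vr3] /andP[/and3P[r01' r02 r03] /andP[/andP[r12' r13] /andP[r23' _]]]].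
have k1 := layout_cross F1P; have k2 := layout_cross F2P; have k3 := layout_cross F3P.
rewrite /= !inE !negb_or vr0 vr1 r01' in k1; rewrite /= !inE !negb_or vr1 vr2 r12' in k2.
rewrite /= !inE !negb_or vr2 vr3 r23' in k3.
move: (k1 isT) (k2 isT) (k3 isT) => {}k1 {}k2 {}k3.
rewrite -/F1 -/F2 -/F3 in k1 k2 k3.
have D1 : dotv (L F1) v r0 r1 = dotv p v r0 r1 by exact: layout_dotv.
have D2 : dotv (L F2) v r1 r2 = dotv p v r1 r2 by exact: layout_dotv.
have D3 : dotv (L F3) v r2 r3 = dotv p v r2 r3 by exact: layout_dotv.
have E0 : dotv (L F1) v r0 r0 = dotv p v r0 r0 by exact: layout_dotv.
have E1 : dotv (L F2) v r1 r1 = dotv p v r1 r1 by exact: layout_dotv.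
have E2 : dotv (L F2) v r2 r2 = dotv p v r2 r2 by exact: layout_dotv.
have E3 : dotv (L F3) v r3 r3 = dotv p v r3 r3 by exact: layout_dotv.
move: n2 h2 n3 h3 h1; rewrite /wide -D1 -D2 -D3 -E0 -E1 -E2 -E3 !dotv_plane.
have i2 (i : 'I_2) : i = 0 \/ i = 1.
  by case: i => [[|[|//]]] h; [left|right]; apply/val_inj.
pose x0 := L F1 r0 0 0 - L F1 v 0 0; pose y0 := L F1 r0 0 1 - L F1 v 0 1.
pose x1 := L F2 r1 0 0 - L F2 v 0 0; pose y1 := L F2 r1 0 1 - L F2 v 0 1.
pose x2 := L F2 r2 0 0 - L F2 v 0 0; pose y2 := L F2 r2 0 1 - L F2 v 0 1.
pose x3 := L F3 r3 0 0 - L F3 v 0 0; pose y3 := L F3 r3 0 1 - L F3 v 0 1.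
rewrite L1 Lv12 in k1 *; rewrite -L2 -Lv23 in k3 *.
move=> n2 h2 n3 h3 h1.
have [a [b [c [d [[a0 b0 c0 d0] H]]]]] : exists a b c d : R, [/\ 0 <= a, 0 < b, 0 <= c & 0 <= d] /\
  [\/ (a * x1 + b * x0 = c * x1 + d * x2 /\ a * y1 + b * y0 = c * y1 + d * y2),
      (a * x2 + b * x1 = c * x2 + d * x3 /\ a * y2 + b * y1 = c * y2 + d * y3) |
      (a * x1 + b * x0 = c * x2 + d * x3 /\ a * y1 + b * y0 = c * y2 + d * y3)].
  by apply: (@planar_overlap _ _ _ _ _ _ _ _ _ eta); rewrite /x0 /y0 /x1 /y1 /x2 /y2 /x3 /y3 ?Lv12 -?Lv23 ?expr2.
have perm3 x y : [set v; x; y] = [set v; y; x] by rewrite -!setUA [[set x] :|: _]setUC.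
(* In each of the three cases [b] is the weight of a vertex that is absent from the other face, so
   [layout_wedge] makes it vanish. *)
suff : b = 0 by move=> b_0; rewrite b_0 ltxx in b0.
rewrite /x0 /y0 /x1 /y1 /x2 /y2 /x3 /y3 Lv12 -Lv23 in H.
case: H => -[hx hy].
- apply: (@layout_wedge v r1 r0 r1 r2 a b c d) => //=; rewrite ?[[set v; r1; r0]]perm3 //.
  + by rewrite !inE !negb_or vr1 vr0 [r1 == _]eq_sym r01'.
  + by rewrite !inE negb_or r01' r02.
  + exact: ltW.
  + by move=> i; rewrite -/F1 -/F2 L1 Lv12; case: (i2 i) => ->.
- apply: (@layout_wedge v r2 r1 r2 r3 a b c d) => //=; rewrite ?[[set v; r2; r1]]perm3 //.
  + by rewrite !inE !negb_or vr2 vr1 [r2 == _]eq_sym r12'.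
  + by rewrite !inE negb_or r12' r13.
  + exact: ltW.
  + by move=> i; rewrite -/F2 -/F3 -L2 -Lv23; case: (i2 i) => ->.
apply: (@layout_wedge v r1 r0 r2 r3 a b c d) => //=; rewrite ?[[set v; r1; r0]]perm3 //.
+ by rewrite -/F1 -/F3 Lv12.
+ by rewrite !inE !negb_or vr1 vr0 [r1 == _]eq_sym r01'.
+ by rewrite !inE negb_or r02 r03.
+ exact: ltW.
by move=> i; rewrite -/F1 -/F3 L1 Lv12 -L2 -Lv23; case: (i2 i) => ->.
Qed.

Lemma layout_tip t a b c : uniq [:: t; a; b; c] -> affindep p [set t; a; b; c] ->
  let F1 := [set t; a; b] in let F2 := [set t; b; c] in let F3 := [set t; c; a] in
  F1 \in P -> F2 \in P -> F3 \in P -> fadj T C F1 F2 -> fadj T C F2 F3 -> fadj T C F3 F1 -> False.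
Proof.
move=> U ind F1 F2 F3 F1P F2P F3P a12 a23 a31.
have m1 : [/\ t \in F1, a \in F1 & b \in F1] by rewrite !inE !eqxx !orbT.
have m2 : [/\ t \in F2, b \in F2 & c \in F2] by rewrite !inE !eqxx !orbT.
have m3 : [/\ t \in F3, c \in F3 & a \in F3] by rewrite !inE !eqxx !orbT.
case: m1 m2 m3 => t1 aF1 bF1 [t2 bF2 cF2] [t3 cF3 aF3].
have Lt12 := layout_glue F1P F2P a12 t1 t2; have Lt23 := layout_glue F2P F3P a23 t2 t3.
have Lb := layout_glue F1P F2P a12 bF1 bF2; have Lc := layout_glue F2P F3P a23 cF2 cF3.
have La := layout_glue F3P F1P a31 aF3 aF1.
have k1 := layout_cross F1P; move: (U); rewrite /= !inE !negb_or => /andP[/and3P[ta tb tc] /andP[/andP[ab ac] /andP[bc _]]].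
rewrite /= !inE !negb_or ta tb ab in k1; move: (k1 isT) => {}k1; rewrite -/F1 in k1.
have Daa : dotv (L F1) t a a = dotv p t a a by exact: layout_dotv.
have Dbb : dotv (L F1) t b b = dotv p t b b by exact: layout_dotv.
have Dab : dotv (L F1) t a b = dotv p t a b by exact: layout_dotv.
have Dcc : dotv (L F2) t c c = dotv p t c c by exact: layout_dotv.
have Dbc : dotv (L F2) t b c = dotv p t b c by exact: layout_dotv.
have Dac : dotv (L F3) t a c = dotv p t a c by exact: layout_dotv.
pose xa := L F1 a 0 0 - L F1 t 0 0; pose ya := L F1 a 0 1 - L F1 t 0 1.
pose xb := L F1 b 0 0 - L F1 t 0 0; pose yb := L F1 b 0 1 - L F1 t 0 1.
pose xc := L F2 c 0 0 - L F1 t 0 0; pose yc := L F2 c 0 1 - L F1 t 0 1.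
(* Three plane vectors satisfy a linear relation whose coefficients are their cross products. The
   spatial combination with the same coefficients has the same dot products, hence length 0, against
   affine independence. *)
have [|||||_ _ z0] := @affindep_quad _ _ _ p t a b c (xb * yc - yb * xc) (xc * ya - yc * xa) (xa * yb - ya * xb) _ ind U; rewrite ?inE ?eqxx ?orbT //.
  rewrite -Daa -Dbb -Dab -Dcc -Dbc -Dac !dotv_plane La -Lc -Lb -Lt23 -Lt12.
  by rewrite -/xa -/ya -/xb -/yb -/xc -/yc; ring.
by move: k1; rewrite -/xa -/ya -/xb -/yb z0 eqxx.
Qed.

End Piece.
End Layout.

(** * Forced cuts and the count of pieces *)

Section Cuts.
Variables (R : realType) (m : nat) (p : 'I_m -> 'rV[R]_3) (T C : {set {set 'I_m}}).
Hypothesis uT : fan_unique p T.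
Hypothesis T3 : forall F, F \in T -> #|F| = 3%N.
Hypothesis mT : manifold T.
Hypothesis vC : valid_unfolding p T C.
Implicit Types (F G e : {set 'I_m}) (v r x y z t : 'I_m).

Lemma fadj_sym : symmetric (fadj T C).
Proof.
move=> F G; rewrite /fadj (setIC F) (eq_sym F).
by case: (F \in T); case: (G \in T); rewrite //= andbF.
Qed.

Lemma setI_triple v x y z : uniq [:: v; x; y; z] -> [set v; x; y] :&: [set v; y; z] = [set v; y].
Proof.
rewrite /= !inE !negb_or => /andP[/and3P[vx vy vz] /andP[/andP[xy xz] /andP[yz _]]].
apply/setP => u; rewrite !inE; have [//|uv] := eqVneq u v.
have [->|uy] := eqVneq u y; first by rewrite orbT.
by rewrite !orbF /=; have [->|] := eqVneq u x; first by rewrite (negPf xz).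
Qed.

Lemma fadj_triple v x y z : uniq [:: v; x; y; z] -> [set v; x; y] \in T -> [set v; y; z] \in T ->
  [set v; y] \notin C -> fadj T C [set v; x; y] [set v; y; z].
Proof.
move=> U FT GT eC; rewrite /fadj FT GT setI_triple // eC andbT /=.
move: (U); rewrite /= !inE !negb_or => /andP[/and3P[vx vy vz] /andP[/andP[xy xz] /andP[yz _]]].
rewrite cards2 vy andbT; apply: contraTneq xz => e.
have : x \in [set v; y; z] by rewrite -e !inE eqxx orbT.
by rewrite !inE [x == v]eq_sym (negPf vx) (negPf xy) /= => ->.
Qed.

Lemma piece_layout F : F \in T -> exists (P : {set {set 'I_m}}) L, [/\ P \subset T, good_layout p T C P L &
  forall G, G \in T -> connect (fadj T C) F G -> G \in P].
Proof.
move=> FT; have [_ h] := vC.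
have /h[L gl] : [set G in T | connect (fadj T C) F G] \in pieces T C by apply/imsetP; exists F.
exists [set G in T | connect (fadj T C) F G], L; split=> //.
  by apply/subsetP => G; rewrite inE => /andP[].
by move=> G GT FG; rewrite inE GT.
Qed.

Lemma corner_cut v r0 r1 r2 r3 eta : uniq [:: v; r0; r1; r2; r3] ->
  [set v; r0; r1] \in T -> [set v; r1; r2] \in T -> [set v; r2; r3] \in T ->
  1 / 2 < eta -> eta <= 1 -> obtuse p v r1 r2 eta -> obtuse p v r2 r3 eta -> wide p v r0 r1 eta ->
  ([set v; r1] \in C) || ([set v; r2] \in C).
Proof.
move=> U F1T F2T F3T e1 e2 o2 o3 w1; apply: contraT; rewrite negb_or => /andP[c1 c2].
have U1 : uniq [:: v; r0; r1; r2] := mask_uniq U [:: true; true; true; true].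
have U2 : uniq [:: v; r1; r2; r3] := mask_uniq U [:: true; false; true; true; true].
have a12 := fadj_triple U1 F1T F2T c1; have a23 := fadj_triple U2 F2T F3T c2.
have [P [L [PT gl inP]]] := piece_layout F1T.
have c12 := connect1 a12.
have [] := layout_corner uT PT gl U (inP _ F1T (connect0 _ _)) (inP _ F2T c12)
  (inP _ F3T (connect_trans c12 (connect1 a23))) a12 a23 e1 e2 o2 o3 w1.
Qed.

Lemma tip_cut t a b c : uniq [:: t; a; b; c] -> affindep p [set t; a; b; c] ->
  [set t; a; b] \in T -> [set t; b; c] \in T -> [set t; c; a] \in T ->
  [|| [set t; a] \in C, [set t; b] \in C | [set t; c] \in C].
Proof.
move=> U ind F1T F2T F3T; apply: contraT; rewrite !negb_or => /and3P[ca cb cc].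
have [U2 U3] : uniq [:: t; b; c; a] /\ uniq [:: t; c; a; b].
  move: U; rewrite /= !inE !negb_or => /and4P[/and3P[ta tb tc] /andP[ab ac] bc _].
  by rewrite ta tb tc bc [b == a]eq_sym [c == a]eq_sym [c == b]eq_sym ab ac bc.
have a12 := fadj_triple U F1T F2T cb; have a23 := fadj_triple U2 F2T F3T cc.
have a31 := fadj_triple U3 F3T F1T ca.
have [P [L [PT gl inP]]] := piece_layout F1T.
have c12 := connect1 a12.
have [] := layout_tip uT PT gl U ind (inP _ F1T (connect0 _ _)) (inP _ F2T c12)
  (inP _ F3T (connect_trans c12 (connect1 a23))) a12 a23 a31.
Qed.

Definition uncut F := [set e : {set 'I_m} | (e \subset F) && (#|e| == 2%N)] :\: C.

Lemma card_edges F : F \in T -> #|[set e : {set 'I_m} | (e \subset F) && (#|e| == 2%N)]| = 3%N.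
Proof. by move=> FT; rewrite cards_draws T3. Qed.

Lemma uncut_le3 F : F \in T -> (#|uncut F| <= 3)%N.
Proof. by move=> FT; rewrite -(card_edges FT); apply/subset_leq_card/subsetDl. Qed.

Lemma uncut_le2 F e : F \in T -> e \subset F -> #|e| = 2%N -> e \in C -> (#|uncut F| <= 2)%N.
Proof.
move=> FT eF e2 eC; have E := card_edges FT.
set D := [set _ | _] in E; have eD : e \in D by rewrite inE eF e2.
rewrite -(card_rem1 eD E); apply/subset_leq_card/subsetP => x.
by rewrite /uncut -/D !inE => /andP[xC ->]; rewrite andbT; apply: contraNneq xC => ->.
Qed.

Lemma uncut_le1 F e e' : F \in T -> e \subset F -> #|e| = 2%N -> e \in C ->
  e' \subset F -> #|e'| = 2%N -> e' \in C -> e != e' -> (#|uncut F| <= 1)%N.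
Proof.
move=> FT eF e2 eC eF' e2' eC' ee; have E := card_edges FT.
set D := [set _ | _] in E; have eD : e \in D by rewrite inE eF e2.
have E' := card_rem1 eD E; have eD' : e' \in D :\ e by rewrite !inE eq_sym ee eF' e2'.
rewrite -(card_rem1 eD' E'); apply/subset_leq_card/subsetP => x.
rewrite /uncut -/D !inE => /andP[xC ->]; rewrite andbT.
by apply/andP; split; apply: contraNneq xC => ->.
Qed.

(** Distinct neighbours are reached through distinct uncut edges, because an edge lies in at most
    two faces. *)
Lemma degree_uncut F : F \in T -> (#|[set G | fadj T C F G]| <= #|uncut F|)%N.
Proof.
move=> FT; rewrite -(card_in_imset (f := fun G => F :&: G) (D := [set G | fadj T C F G])).
  apply/subset_leq_card/subsetP => e /imsetP[G]; rewrite inE => /and5P[_ _ _ c2 nC] ->.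
  by rewrite !inE nC subsetIl c2.
move=> G H; rewrite !inE => /and5P[_ GT FG /eqP c2 _] /and5P[_ HT FH _ _] e.
apply/eqP; apply: contraT => GH.
have := mT c2; rewrite leqNgt => /negP[].
apply: (@leq_trans #|F |: [set G; H]|).
  by rewrite cardsU1 cards2 !inE negb_or FG FH GH.
apply: subset_leq_card; apply/subsetP => X; rewrite !inE.
case/or3P => /eqP->; apply/andP; split=> //; rewrite ?subsetIl ?subsetIr //.
by rewrite e subsetIr.
Qed.

(** [S] holds the faces without a guaranteed cut. Face by face, the degree plus membership in [Gd]
    is at most 2 plus membership in [S]; the sum feeds the component bound. *)
Lemma pieces_lower (S Gd : {set {set 'I_m}}) : S \subset T -> Gd \subset T ->
  (forall F, F \in T :\: S -> #|uncut F| <= 2)%N -> (forall F, F \in Gd -> #|uncut F| <= 1)%N ->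
  (#|Gd| <= #|S| + 2 * #|pieces T C|)%N.
Proof.
move=> ST GT h2 h1.
have h : (2 * #|T| <= 2 * #|pieces T C| + \sum_(F in T) #|[set G | fadj T C F G]|)%N.
  exact: (components_degree fadj_sym (fun F G h => proj1 (andP h))).
have : (\sum_(F in T) #|[set G | fadj T C F G]| + #|Gd| <= 2 * #|T| + #|S|)%N.
  have -> : #|Gd| = (\sum_(F in T) (F \in Gd))%N.
    rewrite -sum1_card big_mkcond [RHS]big_mkcond /=; apply: eq_bigr => F _.
    have [FG|//] := boolP (F \in Gd); last by case: ifP.
    by rewrite (subsetP GT _ FG).
  have -> : #|S| = (\sum_(F in T) (F \in S))%N.
    rewrite -sum1_card big_mkcond [RHS]big_mkcond /=; apply: eq_bigr => F _.
    have [FS|//] := boolP (F \in S); last by case: ifP.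
    by rewrite (subsetP ST _ FS).
  have -> : (2 * #|T| = \sum_(F in T) 2)%N by rewrite sum_nat_const mulnC.
  rewrite -!big_split /=; apply: leq_sum => F FT.
  apply: (@leq_trans (#|uncut F| + (F \in Gd))); first by rewrite leq_add2r degree_uncut.
  have [FG|FG] := boolP (F \in Gd); first by have := h1 F FG; lia.
  have [FS|FS] := boolP (F \in S); first by have := uncut_le3 FT; lia.
  by have := h2 F; rewrite inE FS FT => /(_ isT); lia.
lia.
Qed.

End Cuts.

(** * The polyhedron *)

Section Construction.
Variables (R : realType) (m : nat).
Notation n := (3 * m)%N.
Notation V := 'I_n.+4.

Definition point (x y z : R) : 'rV[R]_3 := \row_i [:: x; y; z]`_i.

Lemma pointD x y z x' y' z' : point x y z + point x' y' z' = point (x + x') (y + y') (z + z').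
Proof. by apply/rowP => -[[|[|[|//]]] h]; rewrite !mxE. Qed.

Lemma pointZ a x y z : a *: point x y z = point (a * x) (a * y) (a * z).
Proof. by apply/rowP => -[[|[|[|//]]] h]; rewrite !mxE. Qed.

Lemma pointN x y z : - point x y z = point (- x) (- y) (- z).
Proof. by apply/rowP => -[[|[|[|//]]] h]; rewrite !mxE. Qed.

Definition chain_abscissa (j : nat) : R := 2^-1 ^+ j.
Notation X := chain_abscissa.
Definition hub (s : bool) : 'rV[R]_3 := point 0 (if s then -1 else 1) 10.
(** The recursion for the chain halves the distance to its fixed point [A + B] = (0, 0, 20), which
    keeps all chain vertices on one line. *)
Definition chain_point (j : nat) : 'rV[R]_3 := point (X j) 0 (20 - 2 * X j).
Notation W := chain_point.

Lemma X_half j : X j = 2 * X j.+1.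
Proof. by rewrite /chain_abscissa exprS mulrA divff ?mul1r // pnatr_eq0. Qed.

Lemma X_gt0 j : 0 < X j. Proof. by apply: exprn_gt0; lra. Qed.

Lemma X_le1 j : X j <= 1. Proof. by apply: exprn_ile1; lra. Qed.

(* Vertices 0, 1, 2, 3 are the hub A, the first chain vertex, the hub B and the bottom D;
   step 3j glues the chain vertex [w j.+1] onto A B [w j], steps 3j+1 and 3j+2 glue the
   tips [tp s j] onto the two faces at the chain edge [w j] [w j.+1]. *)
Definition vx (i : nat) : V := inord i.
Definition hv (s : bool) : V := vx (2 * s).
Definition dd : V := vx 3.
Definition w (j : nat) : V := vx (3 * j + 1).
Definition tp (s : bool) (j : nat) : V := vx (3 * j + 5 + s).

(** From index 4 on, the residue modulo 3 separates chain vertices from the two kinds of tips. The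
    choice for index 3 makes the origin the centroid of the initial tetrahedron. *)
Definition pos (i : nat) : 'rV[R]_3 :=
  if i == 0 then hub false else if i == 2 then hub true
  else if i == 3 then - (hub false + hub true + W 0)
  else if (i %% 3 == 1)%N then W (i %/ 3)%N
  else let j := ((i - 5) %/ 3)%N in hub (i %% 3 == 0)%N + W j + W j.+1.

Definition position (v : V) := pos v.
Notation p := position.

Definition glued_face (k : nat) : {set V} :=
  if (k %% 3 == 0)%N then [set hv false; hv true; w (k %/ 3)%N]
  else [set hv (k %% 3 == 2)%N; w (k %/ 3)%N; w (k %/ 3)%N.+1].
Notation f := glued_face.

Lemma vxE i : (i < n.+4)%N -> vx i = i :> nat. Proof. by move=> h; rewrite inordK. Qed.

Lemma p_hv s : p (hv s) = hub s.
Proof. by rewrite /position vxE; case: s. Qed.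

Lemma p_dd : p dd = - (hub false + hub true + W 0).
Proof. by rewrite /position vxE. Qed.

Lemma p_w j : (j <= m)%N -> p (w j) = W j.
Proof.
move=> jm; rewrite /position vxE; last by lia.
rewrite /pos; have -> : (3 * j + 1 == 0)%N = false by lia.
have -> : (3 * j + 1 == 2)%N = false by lia.
have -> : (3 * j + 1 == 3)%N = false by lia.
have -> : ((3 * j + 1) %% 3 == 1)%N by lia.
by congr W; lia.
Qed.

Lemma p_tp (s : bool) j : (j < m)%N -> p (tp s j) = hub s + W j + W j.+1.
Proof.
move=> jm; rewrite /position vxE; last by case: s; lia.
rewrite /pos; have -> : (3 * j + 5 + s == 0)%N = false by lia.
have -> : (3 * j + 5 + s == 2)%N = false by lia.
have -> : (3 * j + 5 + s == 3)%N = false by lia.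
have -> : ((3 * j + 5 + s) %% 3 == 1)%N = false by case: s; lia.
have -> : ((3 * j + 5 + s - 5) %/ 3 = j)%N by case: s; lia.
by have -> : ((3 * j + 5 + s) %% 3 == 0)%N = s by case: s; lia.
Qed.

Lemma W_half j : W j.+1 = 2^-1 *: (hub false + hub true + W j).
Proof. by rewrite /hub /chain_point !pointD pointZ (X_half j); congr point; field. Qed.

Lemma f0E j : f (3 * j) = [set hv false; hv true; w j].
Proof. by rewrite /glued_face; have -> : (3 * j %% 3 == 0)%N; [lia | have -> : (3 * j %/ 3 = j)%N by lia]. Qed.

Lemma f1E (s : bool) j : f (3 * j + 1 + s) = [set hv s; w j; w j.+1].
Proof.
rewrite /glued_face; have -> : ((3 * j + 1 + s) %% 3 == 0)%N = false by case: s; lia.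
have -> : ((3 * j + 1 + s) %% 3 == 2)%N = s by case: s; lia.
by have -> : ((3 * j + 1 + s) %/ 3 = j)%N by case: s; lia.
Qed.

Lemma apex0E j : apex n (3 * j) = w j.+1.
Proof. by congr inord; lia. Qed.

Lemma apex1E (s : bool) j : apex n (3 * j + 1 + s) = tp s j.
Proof. by congr inord; lia. Qed.

Lemma step_cases k : (k < n)%N -> exists2 j, (j < m)%N & k = (3 * j)%N \/ exists s : bool, k = (3 * j + 1 + s)%N.
Proof.
move=> kn; exists (k %/ 3)%N; first by lia.
have [h|h] := eqVneq (k %% 3)%N 0%N; first by left; lia.
by right; exists (k %% 3 == 2)%N; lia.
Qed.

Lemma vx_uniq (s : seq nat) : all (fun i => i < n.+4)%N s -> uniq s -> uniq (map vx s).
Proof.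
move=> /allP h u; rewrite map_inj_in_uniq // => i j /h hi /h hj e.
by rewrite -(vxE hi) -(vxE hj) e.
Qed.

Lemma vx_inj i j : (i < n.+4)%N -> (j < n.+4)%N -> vx i = vx j -> i = j.
Proof. by move=> hi hj e; rewrite -(vxE hi) -(vxE hj) e. Qed.

(** Glued faces have only such vertices, so a face containing a tip or the bottom vertex is never
    covered again. *)
Definition hub_or_chain (v : V) := [|| v == 0 :> nat, v == 2 :> nat | (v %% 3 == 1)%N].

Lemma f_vertices k v : (k < n)%N -> v \in f k -> hub_or_chain v.
Proof.
move=> /step_cases[j jm [->|[s ->]]]; rewrite ?f0E ?f1E !inE => /orP[/orP[]|] /eqP->;
  rewrite /hub_or_chain vxE; try (case: s); lia.
Qed.

Lemma tp_other (s : bool) j : (j < m)%N -> ~~ hub_or_chain (tp s j).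
Proof. by move=> jm; rewrite /hub_or_chain vxE; case: s; lia. Qed.

Lemma dd_other : ~~ hub_or_chain dd.
Proof. by rewrite /hub_or_chain vxE. Qed.

Notation T k := (surf f k).

Lemma set3_rot (x y z : V) : [set x; y; z] = [set y; z; x].
Proof. by rewrite -setUA setUC. Qed.

Lemma set3_swap (x y z : V) : [set x; y; z] = [set x; z; y].
Proof. by rewrite -!setUA [[set y] :|: _]setUC. Qed.

Lemma set3_rem (x y z : V) : uniq [:: x; y; z] -> [set x; y; z] :\ x = [set y; z].
Proof.
rewrite /= !inE !negb_or => /andP[/andP[xy xz] _]; apply/setP => u; rewrite !inE.
have [->|//] := eqVneq u x; by rewrite (negPf xy) (negPf xz).
Qed.

Lemma card_set3 (x y z : V) : uniq [:: x; y; z] -> #|[set x; y; z]| = 3%N.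
Proof.
rewrite /= !inE !negb_or => /andP[/andP[xy xz] /andP[yz _]].
by rewrite -setUA cardsU1 cards2 !inE negb_or xy xz yz.
Qed.

Lemma uniq3_rot (x y z : V) : uniq [:: x; y; z] -> uniq [:: y; z; x].
Proof. by move=> U; rewrite -(rot_uniq 2). Qed.

Lemma surf_new k x y z : f k = [set x; y; z] -> uniq [:: x; y; z] ->
  [/\ [set apex n k; y; z] \in T k.+1, [set apex n k; z; x] \in T k.+1 & [set apex n k; x; y] \in T k.+1].
Proof.
move=> e U.
have h u : u \in f k -> apex n k |: (f k :\ u) \in T k.+1.
  by move=> uf; rewrite inE; apply/orP; right; apply/imsetP; exists u.
split.
- by have := h x; rewrite e set3_rem // setUA; apply; rewrite !inE eqxx.
- have := h y; rewrite e set3_rot set3_rem; last exact: uniq3_rot.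
  by rewrite setUA; apply; rewrite !inE eqxx.
have := h z; rewrite e (set3_rot x) (set3_rot y) set3_rem; last by do 2 apply: uniq3_rot.
by rewrite setUA; apply; rewrite !inE eqxx.
Qed.

Lemma surf_keep k (F : {set V}) : F \in T k -> F != f k -> F \in T k.+1.
Proof. by move=> FT Ff; rewrite !inE Ff FT. Qed.

Lemma surf_cases k x y z (F : {set V}) : f k = [set x; y; z] -> uniq [:: x; y; z] -> F \in T k.+1 ->
  [\/ F \in T k /\ F <> f k, F = [set apex n k; y; z], F = [set apex n k; z; x] | F = [set apex n k; x; y]].
Proof.
move=> e U; rewrite inE => /orP[|/imsetP[v vf ->]].
  by rewrite in_setD1 => /andP[Ff FT]; constructor 1; split=> //; apply/eqP.
move: vf; rewrite e !inE => /orP[/orP[]|] /eqP->.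
- by constructor 2; rewrite set3_rem // setUA.
- by constructor 3; rewrite set3_rot set3_rem ?setUA //; exact: uniq3_rot.
by constructor 4; rewrite (set3_rot x) (set3_rot y) set3_rem ?setUA //; do 2 apply: uniq3_rot.
Qed.

Lemma surf_persist k l (F : {set V}) v : (k <= l <= n)%N -> v \in F -> ~~ hub_or_chain v -> F \in T k -> F \in T l.
Proof.
move=> /andP[kl ln] vF nv FT; elim: l kl ln => [|l IH]; first by rewrite leqn0 => /eqP k0; rewrite k0 in FT.
rewrite leq_eqVlt => /orP[/eqP <- //|kl] ln; apply: surf_keep; first by apply: IH => //; exact: ltnW.
by apply: contraNneq nv => e; apply: (f_vertices ln); rewrite -e.
Qed.

Lemma uniq_f0 j : (j <= m)%N -> uniq [:: hv false; hv true; w j].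
Proof. by move=> jm; apply: (@vx_uniq [:: 0; 2; 3 * j + 1]%N); rewrite /= ?inE; lia. Qed.

Lemma uniq_f1 (s : bool) j : (j < m)%N -> uniq [:: hv s; w j; w j.+1].
Proof. by move=> jm; apply: (@vx_uniq [:: 2 * s; 3 * j + 1; 3 * j.+1 + 1]%N); rewrite /= ?inE; case: s; lia. Qed.

Lemma neq_mem (F G : {set V}) v : v \in F -> v \notin G -> F != G.
Proof. by move=> vF; apply: contraNneq => <-. Qed.

Lemma hvN (s : bool) j : (j < m)%N -> hv (~~ s) \notin [set hv s; w j; w j.+1].
Proof.
move=> jm; have : uniq [:: hv (~~ s); hv s; w j; w j.+1].
  by apply: (@vx_uniq [:: 2 * (~~ s); 2 * s; 3 * j + 1; 3 * j.+1 + 1]%N); rewrite /= ?inE; case: s; lia.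
by rewrite /= !inE !negb_or => /andP[/and3P[-> -> ->]].
Qed.

Lemma roof_neq (s : bool) j : (j < m)%N ->
  [set hv false; hv true; w j.+1] != [set hv s; w j; w j.+1].
Proof.
move=> jm; apply: (@neq_mem _ _ (hv (~~ s))); last exact: hvN.
by case: s; rewrite !inE eqxx ?orbT.
Qed.

Lemma surf_roof (s : bool) j : (j < m)%N -> [set hv false; hv true; w j.+1] \in T (3 * j + 1 + s).
Proof.
move=> jm; have [_ _] := surf_new (f0E j) (uniq_f0 (ltnW jm)); rewrite apex0E => h; rewrite set3_rot in h.
have h0 : [set hv false; hv true; w j.+1] \in T (3 * j + 1 + false).
  by have -> : (3 * j + 1 + false = (3 * j).+1)%N by lia.
case: s => //; have -> : (3 * j + 1 + true = (3 * j + 1 + false).+1)%N by lia.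
by apply: surf_keep => //; rewrite f1E roof_neq.
Qed.

Lemma surf_chain j : (j <= m)%N -> [set hv false; hv true; w j] \in T (3 * j).
Proof.
elim: j => [|j IH] jm.
  rewrite muln0 inE; apply/andP; split.
    by apply/subsetP => x; rewrite !inE => /orP[/orP[]|] /eqP->; rewrite vxE.
  by rewrite card_set3 // uniq_f0.
have -> : (3 * j.+1 = (3 * j + 1 + true).+1)%N by lia.
by apply: surf_keep; [exact: surf_roof | rewrite f1E; apply: roof_neq].
Qed.

Lemma surf_side0 j : (j < m)%N -> forall s, [set hv s; w j; w j.+1] \in T (3 * j).+1.
Proof.
move=> jm; have [h1 h2 _] := surf_new (f0E j) (uniq_f0 (ltnW jm)).
rewrite apex0E in h1 h2; case; first by rewrite -set3_rot.
by rewrite set3_swap set3_rot.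
Qed.

Lemma surf_side1 j : (j < m)%N -> [set hv true; w j; w j.+1] \in T (3 * j).+2.
Proof.
move=> jm; apply: surf_keep; first exact: surf_side0.
have -> : ((3 * j).+1 = 3 * j + 1 + false)%N by lia.
rewrite f1E; apply: (@neq_mem _ _ (hv true)); last by exact: (@hvN false).
  by rewrite !inE eqxx.
Qed.

Lemma surf_side (s : bool) j : (j < m)%N -> [set hv s; w j; w j.+1] \in T (3 * j + 1 + s).
Proof.
move=> jm; case: s.
  by have -> : (3 * j + 1 + true = (3 * j).+2)%N; [lia | exact: surf_side1].
by have -> : (3 * j + 1 + false = (3 * j).+1)%N; [lia | exact: surf_side0].
Qed.

Lemma f_in k : (k < n)%N -> f k \in T k.
Proof.
move=> /step_cases[j jm [->|[s ->]]]; rewrite ?f0E ?f1E; first by apply: surf_chain; exact: ltnW.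
exact: surf_side.
Qed.

Lemma surf_spike (s : bool) j k : (j < m)%N -> (3 * j + 2 + s <= k <= n)%N ->
  [/\ [set tp s j; w j; w j.+1] \in T k, [set tp s j; w j.+1; hv s] \in T k & [set tp s j; hv s; w j] \in T k].
Proof.
move=> jm kn; have [] := surf_new (f1E s j) (uniq_f1 s jm); rewrite apex1E => h1 h2 h3.
have le : ((3 * j + 1 + s).+1 <= k <= n)%N by lia.
by split; apply: (surf_persist le _ (tp_other s jm)); rewrite // !inE eqxx.
Qed.

Lemma surf_dd k : (k <= n)%N -> [set dd; hv false; hv true] \in T k /\ forall s, [set dd; hv s; w 0] \in T k.
Proof.
move=> kn.
have h (i j : nat) : (i < 3)%N -> (j < 3)%N -> i != j -> [set dd; vx i; vx j] \in T k.
  move=> i3 j3 ij; apply: (@surf_persist 0 k _ dd) => //; [by rewrite !inE eqxx | exact: dd_other |].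
  rewrite inE; apply/andP; split.
    by apply/subsetP => x; rewrite !inE => /orP[/orP[]|] /eqP->; rewrite vxE; lia.
  by rewrite card_set3 //; apply: (@vx_uniq [:: 3; i; j]%N); rewrite /= ?inE; lia.
by split=> [|[]]; apply: h.
Qed.

Lemma tet0E : tet0 n = [set vx 0; vx 1; vx 2; vx 3].
Proof.
apply/setP => x; rewrite !inE; apply/idP/idP => [x4|]; last first.
  by move=> /orP[/orP[/orP[]|]|] /eqP->; rewrite vxE.
have xv : x = vx x by apply/ord_inj; rewrite vxE.
by rewrite xv; case: (nat_of_ord x) x4 => [|[|[|[|]]]] // _; rewrite eqxx ?orbT.
Qed.

Definition spike s j (F : {set V}) := [\/ F = [set tp s j; w j; w j.+1],
  F = [set tp s j; w j.+1; hv s] | F = [set tp s j; hv s; w j]].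

(** Completeness of the face list is what confines the faces without a forced cut to a constant
    number. *)
Lemma surf_desc j F : (j <= m)%N -> F \in T (3 * j) ->
  [\/ F = [set hv false; hv true; w j], F = [set dd; hv false; hv true], exists s, F = [set dd; hv s; w 0] |
   exists s i, (i < j)%N /\ spike s i F].
Proof.
elim: j F => [|j IH] F jm.
  rewrite muln0 inE => /andP[Ft /eqP F3].
  have [u uF eF] : exists2 u, u \in tet0 n & F = tet0 n :\ u.
    have c1 : #|tet0 n :\: F| == 1%N by have := cardsID F (tet0 n); rewrite (setIidPr Ft) card_tet0 F3; lia.
    have /cards1P[u eu] := c1; exists u.
      have : u \in tet0 n :\: F by rewrite eu set11.
      by rewrite inE => /andP[].
    by rewrite -eu setDDr setDv set0U (setIidPr Ft).
  have E := tet0E.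
  have rem4 (a b c d : V) : uniq [:: a; b; c; d] -> [set a; b; c; d] :\ d = [set a; b; c].
    rewrite /= !inE !negb_or => /and4P[/and3P[_ _ ad] /andP[_ bd] cd _]; apply/setP => v; rewrite !inE.
    by have [->|] := eqVneq v d; rewrite ?orbF // ![d == _]eq_sym (negPf ad) (negPf bd) (negPf cd).
  have rot4 (a b c d : V) : [set a; b; c; d] = [set b; c; d; a] by rewrite -!setUA setUC -!setUA.
  have U (s : seq nat) : all (fun i => i < 4)%N s -> uniq s -> uniq (map vx s).
    by move=> /allP h; apply: vx_uniq; apply/allP => i /h; lia.
  move: uF; rewrite eF {}E !inE => /orP[/orP[/orP[]|]|] /eqP->.
  - constructor 3; exists true; rewrite rot4 rem4; last exact: (U [:: 1; 2; 3; 0]%N).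
    by rewrite set3_swap set3_rot set3_rot set3_swap set3_rot set3_swap.
  - constructor 2; rewrite rot4 rot4 rem4; last exact: (U [:: 2; 3; 0; 1]%N).
    by rewrite set3_rot set3_swap.
  - constructor 3; exists false; rewrite rot4 rot4 rot4 rem4; last exact: (U [:: 3; 0; 1; 2]%N).
    by [].
  constructor 1; rewrite rem4; last exact: (U [:: 0; 1; 2; 3]%N).
  by rewrite set3_swap.
have e3 : (3 * j.+1 = (3 * j).+3)%N by lia.
have e2 : ((3 * j).+2 = 3 * j + 1 + true)%N by lia.
have e1 : ((3 * j).+1 = 3 * j + 1 + false)%N by lia.
have sp (s : bool) : spike s j F -> [\/ F = [set hv false; hv true; w j.+1], F = [set dd; hv false; hv true],
    exists s, F = [set dd; hv s; w 0] | exists s i, (i < j.+1)%N /\ spike s i F].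
  by move=> h; constructor 4; exists s, j.
rewrite e3 => FT.
have : F \in T (3 * j + 1 + true).+1 by rewrite -e2.
case/(surf_cases (f1E true j) (uniq_f1 true jm)); rewrite ?apex1E.
- rewrite -{1}e2 => -[+ Ff1]; rewrite {1}e1.
  case/(surf_cases (f1E false j) (uniq_f1 false jm)); rewrite ?apex1E.
  + rewrite -{1}e1 => -[+ Ff0]; rewrite f1E in Ff1; rewrite f1E in Ff0.
    case/(surf_cases (f0E j) (uniq_f0 (ltnW jm))); rewrite ?apex0E.
    * case=> /(IH _ (ltnW jm)) + Ff; rewrite f0E in Ff.
      case=> [//|h|h|[s [i [ij h]]]]; [by constructor 2 | by constructor 3 |].
      by constructor 4; exists s, i; split=> //; apply: ltnW.
    (* The side faces at the new chain edge are exactly the ones just covered by the two spikes. *)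
    * by move=> h; case: Ff1; rewrite h; exact: set3_rot.
    * by move=> h; case: Ff0; rewrite h (set3_swap (w j.+1)); exact: set3_rot.
    by move=> h; constructor 1; rewrite h; exact: set3_rot.
  + by move=> h; apply: (sp false); constructor 1.
  + by move=> h; apply: (sp false); constructor 2.
  by move=> h; apply: (sp false); constructor 3.
- by move=> h; apply: (sp true); constructor 1.
- by move=> h; apply: (sp true); constructor 2.
by move=> h; apply: (sp true); constructor 3.
Qed.

(** * Linear relations between the vertices *)

Definition lin3 (x y z : V) (a b c : R) (v : V) : R := 0 + a * (v == x)%:R + b * (v == y)%:R + c * (v == z)%:R.

Lemma comb_lin3 x y z a b c : comb p (lin3 x y z a b c) = a *: p x + b *: p y + c *: p z.
Proof. by rewrite !combD !comb_delta comb0 add0r. Qed.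

Lemma sum_lin3 x y z a b c : \sum_v lin3 x y z a b c v = a + b + c.
Proof.
have s1 (u : V) : \sum_v (v == u)%:R = 1 :> R.
  by rewrite (bigD1 u) //= eqxx big1 ?addr0 // => v /negPf ->.
by rewrite !big_split /= -!mulr_sumr !s1 big1 // add0r !mulr1.
Qed.

Lemma lin3_out x y z a b c v : v \notin [set x; y; z] -> lin3 x y z a b c v = 0.
Proof.
by rewrite !inE !negb_or => /andP[/andP[/negPf vx' /negPf vy] /negPf vz]; rewrite /lin3 vx' vy vz /=; ring.
Qed.

Lemma lin3_gt0 x y z a v : 0 < a -> v \in [set x; y; z] -> 0 < lin3 x y z a a a v.
Proof.
by move=> a0; rewrite !inE /lin3; case: (v == x); case: (v == y); case: (v == z) => //= _; lra.
Qed.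

Definition coef (k : nat) : V -> R :=
  let j := (k %/ 3)%N in
  if (k %% 3 == 0)%N then lin3 (hv false) (hv true) (w j) 2^-1 2^-1 2^-1
  else lin3 (hv (k %% 3 == 2)%N) (w j) (w j.+1) 1 1 1.

Lemma coef_gt0 k v : v \in f k -> 0 < coef k v.
Proof. by rewrite /glued_face /coef; case: ifP => _; apply: lin3_gt0; lra. Qed.

Lemma coef_out k v : v \notin f k -> coef k v = 0.
Proof. by rewrite /glued_face /coef; case: ifP => _; apply: lin3_out. Qed.

Lemma coef_sum k : 1 < \sum_v coef k v.
Proof. by rewrite /coef; case: ifP => _; rewrite sum_lin3; lra. Qed.

Lemma p_apex k : (k < n)%N -> p (apex n k) = comb p (coef k).
Proof.
move=> /step_cases[j jm [->|[s ->]]]; rewrite ?apex0E ?apex1E /coef.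
  have -> : (3 * j %% 3 == 0)%N by lia.
  have -> : (3 * j %/ 3 = j)%N by lia.
  by rewrite comb_lin3 !p_hv !p_w ?(ltnW jm) // W_half !scalerDr.
have -> : ((3 * j + 1 + s) %% 3 == 0)%N = false by case: s; lia.
have -> : ((3 * j + 1 + s) %% 3 == 2)%N = s by case: s; lia.
have -> : ((3 * j + 1 + s) %/ 3 = j)%N by case: s; lia.
by rewrite comb_lin3 p_tp // p_hv !p_w ?(ltnW jm) // !scale1r.
Qed.

Lemma big_set4 (U : zmodType) (F : V -> U) a b c d : uniq [:: a; b; c; d] ->
  \sum_(v in [set a; b; c; d]) F v = F a + F b + F c + F d.
Proof.
rewrite /= !inE !negb_or => /and4P[/and3P[ab ac ad] /andP[bc bd] cd _].
rewrite -!setUA big_setU1 /=; last by rewrite !inE !negb_or ab ac ad.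
rewrite big_setU1 /=; last by rewrite !inE !negb_or bc bd.
by rewrite big_setU1 ?big_set1 ?addrA // !inE.
Qed.

Lemma uniq_tet0 : uniq [:: hv false; w 0; hv true; dd].
Proof. by apply: (@vx_uniq [:: 0; 1; 2; 3]%N). Qed.

Lemma tet0_vertices : tet0 n = [set hv false; w 0; hv true; dd].
Proof. exact: tet0E. Qed.

Lemma comb_tet0 lam : (forall v, v \notin tet0 n -> lam v = 0) ->
  comb p lam = lam (hv false) *: hub false + lam (w 0) *: W 0 + lam (hv true) *: hub true + lam dd *: - (hub false + hub true + W 0).
Proof.
by move=> supp; rewrite (comb_supp p supp) tet0_vertices (big_set4 _ uniq_tet0) !p_hv p_w // p_dd.
Qed.

Lemma p_span x : exists2 lam, (forall v, v \notin tet0 n -> lam v = 0) & comb p lam = x.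
Proof.
pose a := x 0 0; pose b := x 0 1; pose c := x 0 (inord 2).
exists (lin3 (hv false) (w 0) (hv true) (((c - 18 * a) / 10 + b) / 2) a (((c - 18 * a) / 10 - b) / 2)).
  move=> v; rewrite tet0_vertices => h; apply: lin3_out; apply: contra h.
  by move=> v3; rewrite in_setU v3.
rewrite comb_lin3 !p_hv p_w // /chain_point /hub /chain_abscissa expr0 !pointZ !pointD.
apply/rowP => -[[|[|[|//]]] h]; rewrite !mxE /=.
- by rewrite (_ : Ordinal h = 0) -/a; [ring | apply/val_inj].
- by rewrite (_ : Ordinal h = 1) -/b; [field | apply/val_inj].
by rewrite (_ : Ordinal h = inord 2) -/c; [field | apply/val_inj; rewrite /= inordK].
Qed.

Lemma p_rel : comb p (fun v => (v \in tet0 n)%:R) = 0.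
Proof.
rewrite comb_tet0 => [|v /negPf->//]; rewrite tet0_vertices !inE !eqxx !orbT !scale1r.
by rewrite (addrAC (hub false)) subrr.
Qed.

Lemma p_ker lam : (forall v, v \notin tet0 n -> lam v = 0) -> comb p lam = 0 ->
  exists a, forall v, v \in tet0 n -> lam v = a.
Proof.
move=> supp; rewrite comb_tet0 // /chain_point /hub /chain_abscissa expr0 !pointD pointN !pointZ !pointD => e.
have [ex ey ez] : [/\ lam (w 0) - lam dd = 0, lam (hv false) - lam (hv true) = 0 &
    10 * lam (hv false) + 18 * lam (w 0) + 10 * lam (hv true) - 38 * lam dd = 0].
  split.
  - by have := congr1 (fun M : 'rV[R]_3 => M 0 (Ordinal (isT : (0 < 3)%N))) e; rewrite !mxE /=; lra.
  - by have := congr1 (fun M : 'rV[R]_3 => M 0 (Ordinal (isT : (1 < 3)%N))) e; rewrite !mxE /=; lra.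
  by have := congr1 (fun M : 'rV[R]_3 => M 0 (Ordinal (isT : (2 < 3)%N))) e; rewrite !mxE /=; lra.
exists (lam dd) => v; rewrite tet0_vertices !inE => /orP[/orP[/orP[]|]|] /eqP-> //; lra.
Qed.

Lemma nbrI k v x y z a b c (u : V) : [set x; y; z] \in T k -> u \in [set x; y; z] -> u \notin f k ->
  f k :\ v \subset [set x; y; z] -> p (apex n k) = a *: p x + b *: p y + c *: p z -> a + b + c != 1 ->
  exists G d, [/\ G \in T k, G != f k, f k :\ v \subset G &
   [/\ forall t, t \notin G -> d t = 0, p (apex n k) = comb p d & \sum_t d t != 1]].
Proof.
move=> GT uG uf sub e s1; exists [set x; y; z], (lin3 x y z a b c); split=> //.
  by apply: (neq_mem uG).
by split; [move=> t; apply: lin3_out | rewrite comb_lin3 | rewrite sum_lin3].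
Qed.

(** Expanded in the bottom vertex and the two hubs, a chain vertex of abscissa x has coefficient sum
    2 - 5 x; the value 1/5 would make it coplanar with them. *)
Lemma X_neq j : X j.+1 != 5^-1.
Proof.
case: j => [|[|j]]; rewrite /chain_abscissa ?exprS ?expr0; try by apply/negP => /eqP; lra.
have := X_le1 j; rewrite -/(X j); have := X_gt0 j; move=> h0 h1.
by apply/negP => /eqP; lra.
Qed.

Ltac sub3 := apply/subsetP => ?; rewrite ?f0E ?f1E !inE => /andP[]; move/[swap] => /orP[/orP[]|] /eqP->;
  rewrite ?eqxx ?orbT //.

(** The coefficients solve for the apex in the three vertices of the face across the edge, which is
    a bottom face, a face of an earlier spike, the roof, or the opposite side face. *)
Lemma p_nbr k : (k < n)%N -> forall v, v \in f k -> exists G d,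
  [/\ G \in T k, G != f k, f k :\ v \subset G &
   [/\ forall u, u \notin G -> d u = 0, p (apex n k) = comb p d & \sum_u d u != 1]].
Proof.
move=> kn; have kn' := ltnW kn; have dnf : dd \notin f k by apply: contra dd_other; exact: f_vertices.
have tnf s i : (i < m)%N -> tp s i \notin f k by move=> im; apply: contra (tp_other s im); exact: f_vertices.
have [j jm] := step_cases kn; have jm' := ltnW jm.
have [hd hds] := surf_dd kn'.
case=> [ek|[s ek]] v.
  have ap : apex n k = w j.+1 by rewrite ek apex0E.
  have hub_case s : v = hv s -> exists G d,
      [/\ G \in T k, G != f k, f k :\ v \subset G &
       [/\ forall u, u \notin G -> d u = 0, p (apex n k) = comb p d & \sum_u d u != 1]].
    move=> ev; have [j0|[i ei]] : j = 0%N \/ exists i, j = i.+1 by case: (j) => [|i]; [left|right; exists i].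
      apply: (@nbrI k v dd (hv (~~ s)) (w 0) (- 2^-1) 0 0 dd) => //.
      + by rewrite !inE eqxx.
      + rewrite ev ek j0; case: (s) => /=; sub3.
      + rewrite ap j0 p_dd p_w //; last by lia.
        rewrite !scale0r !addr0 scalerN scaleNr opprK; exact: W_half.
      by rewrite !addr0; apply/negP => /eqP; lra.
    have im : (i < m)%N by lia.
    have le : (3 * i + 2 + ~~ s <= k <= n)%N by rewrite kn' ek ei; case: (s); lia.
    have [_ h _] := surf_spike im le.
    apply: (@nbrI k v (tp (~~ s) i) (hv (~~ s)) (w j) (- 2^-1) (2^-1) 2 (tp (~~ s) i)); rewrite ?tnf //.
    + by rewrite ei set3_swap.
    + by rewrite !inE eqxx.
    + by rewrite ev ek; case: (s) => /=; sub3.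
    + rewrite ap p_hv p_tp // !p_w // ei /chain_point /hub (X_half i) (X_half i.+1) !pointD !pointZ !pointD.
      by congr point; case: (s) => /=; field.
    by apply/negP => /eqP; lra.
  rewrite {1}ek f0E !inE => /orP[/orP[]|] /eqP ev; [exact: (hub_case _ ev) | exact: (hub_case _ ev)|].
  (* The edge between the hubs keeps the same bottom face across it in every round, so here the
     coefficients vary with [j]. *)
  apply: (@nbrI k v dd (hv false) (hv true) (- X j.+1) (1 - 2 * X j.+1) (1 - 2 * X j.+1) dd) => //.
  - by rewrite !inE eqxx.
  - by rewrite ev ek; sub3.
  - rewrite ap p_dd !p_hv p_w // /chain_point /hub /(chain_abscissa 0) expr0 !pointD pointN !pointZ !pointD.
    by congr point; ring.
  by apply/negP => /eqP h; have /eqP := X_neq j; apply; lra.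
have ap : apex n k = tp s j by rewrite ek apex1E.
have hvn : hv (~~ s) \notin f k by rewrite ek f1E hvN.
rewrite {1}ek f1E !inE => /orP[/orP[]|] /eqP ev.
(* When the second spike of a round is glued, the first already covers the opposite side face. *)
- case: s => [|] in ek ap ev hvn *.
    have le : (3 * j + 2 + false <= k <= n)%N by rewrite kn' ek; lia.
    have [h _ _] := @surf_spike false j k jm le.
    apply: (@nbrI k v (tp false j) (w j) (w j.+1) (-1) 1 4 (tp false j)); rewrite ?tnf //.
    + by rewrite !inE eqxx.
    + by rewrite ev ek; sub3.
    + rewrite ap !p_tp // !p_w // /chain_point /hub (X_half j) !pointD !pointZ !pointD.
      by congr point => /=; ring.
    by apply/negP => /eqP; lra.
  apply: (@nbrI k v (hv true) (w j) (w j.+1) (-1) 0 3 (hv true)) => //.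
  + by have := surf_side0 jm true; rewrite ek; have -> : (3 * j + 1 + false = (3 * j).+1)%N by lia.
  + by rewrite !inE eqxx.
  + by rewrite ev ek; sub3.
  + rewrite ap !p_tp // p_hv !p_w // /chain_point /hub (X_half j) !pointD !pointZ !pointD.
    by congr point => /=; ring.
  by apply/negP => /eqP; lra.
- apply: (@nbrI k v (hv s) (hv (~~ s)) (w j.+1) 0 (-1) 3 (hv (~~ s))) => //.
  + have := @surf_roof s j jm; rewrite ek; case: (s) => //=.
    by rewrite [[set hv true; _]]setUC.
  + by rewrite !inE eqxx orbT.
  + by rewrite ev ek; sub3.
  + rewrite ap !p_tp // !p_hv !p_w // /chain_point /hub (X_half j) !pointD !pointZ !pointD.
    by congr point; case: (s) => /=; ring.
  by apply/negP => /eqP; lra.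
have [j0|[i ei]] : j = 0%N \/ exists i, j = i.+1 by case: (j) => [|i]; [left|right; exists i].
  apply: (@nbrI k v dd (hv s) (w 0) (- 2^-1) 1 1 dd) => //.
  + by rewrite !inE eqxx.
  + by rewrite ev ek j0; sub3.
  + rewrite ap j0 p_tp ?p_dd ?p_hv ?p_w //; last by lia.
    have X0 : X 0 = 1 by rewrite /chain_abscissa expr0.
    have X1 : X 1 = 2^-1 by rewrite /chain_abscissa expr1.
    rewrite /chain_point /hub X0 X1 !pointD pointN !pointZ !pointD.
    by congr point; case: (s) => /=; field.
  by apply/negP => /eqP; lra.
have im : (i < m)%N by lia.
have le : (3 * i + 2 + s <= k <= n)%N by rewrite kn' ek ei; case: (s); lia.
have [_ h _] := surf_spike im le.
apply: (@nbrI k v (tp s i) (hv s) (w j) (- 2^-1) (3 / 2) 3 (tp s i)); rewrite ?tnf //.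
+ by rewrite ei set3_swap.
+ by rewrite !inE eqxx.
+ by rewrite ev ek; sub3.
+ rewrite ap p_hv !p_tp // !p_w // ei /chain_point /hub (X_half i) (X_half i.+1) !pointD !pointZ !pointD.
  by congr point; case: (s) => /=; field.
by apply/negP => /eqP; lra.
Qed.

Lemma construction_stacked : stacked p f.
Proof.
apply: (fan_stacked p_rel p_ker f_in (c := coef)) => [k _ v|k _ v|k|k _|].
- exact: coef_gt0.
- exact: coef_out.
- exact: p_apex.
- exact: coef_sum.
exact: p_nbr.
Qed.

Lemma final_unique : fan_unique p (T n).
Proof.
apply: (surf_unique p_ker f_in (c := coef)) => // [k _ v|k _ v|k].
- exact: coef_gt0.
- exact: coef_out.
exact: p_apex.
Qed.

Lemma construction_convex : top_convex p (T n).
Proof.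
split; last exact: surf_three_connected f_in.
apply: fan_homeo; first exact: final_unique.
apply: (surf_cover p_span p_rel f_in (c := coef)) => // [k _ v|k _ v|k|k _].
- exact: coef_gt0.
- exact: coef_out.
- exact: p_apex.
exact: coef_sum.
Qed.

Lemma dotv_point (v a b : V) x y z x' y' z' x'' y'' z'' : p v = point x y z -> p a = point x' y' z' ->
  p b = point x'' y'' z'' ->
  dotv p v a b = (x' - x) * (x'' - x) + (y' - y) * (y'' - y) + (z' - z) * (z'' - z).
Proof. by move=> ev ea eb; rewrite /dotv !big_ord_recl big_ord0 addr0 ev ea eb !mxE /= addrA. Qed.

(** * Angle estimates at a chain vertex *)

Section Angles.
Variables (s : bool) (i : nat).
Hypothesis im : (i.+1 < m)%N.
Let y := X i.+2.
Let sg : R := if s then -1 else 1.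

Let y_gt0 : 0 < y. Proof. exact: X_gt0. Qed.
Let y_le : y <= 4^-1.
Proof. by have := X_le1 i; rewrite (X_half i) (X_half i.+1) -/y; lra. Qed.

(** The angle conditions are polynomial inequalities in [y]; these bounds let linear arithmetic
    treat the powers of [y] as independent unknowns. *)
Let y_powers : [/\ 0 < y ^+ 2, y ^+ 2 <= y / 4, 0 <= y ^+ 3, y ^+ 3 <= y ^+ 2 / 4 & 0 <= y ^+ 4].
Proof.
have y0 := ltW y_gt0.
have le k : y ^+ k.+1 <= y ^+ k / 4 by rewrite exprSr ler_wpM2l ?exprn_ge0 ?y_le.
by rewrite exprn_gt0 ?y_gt0 // !exprn_ge0 // (le 1%N) le.
Qed.

Let sg2 : sg * sg = 1. Proof. by rewrite /sg; case: s; ring. Qed.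

Let pv : p (w i.+1) = point (2 * y) 0 (20 - 4 * y).
Proof. by rewrite p_w ?(ltnW im) // /chain_point (X_half i.+1); congr point; rewrite /y; ring. Qed.
Let pnext : p (w i.+2) = point y 0 (20 - 2 * y).
Proof. by rewrite p_w. Qed.
Let pprev : p (w i) = point (4 * y) 0 (20 - 8 * y).
Proof. by rewrite p_w ?(ltnW (ltnW im)) // /chain_point (X_half i) (X_half i.+1); congr point; rewrite /y; ring. Qed.
Let phub : p (hv s) = point 0 sg 10.
Proof. exact: p_hv. Qed.
Let ptnext : p (tp s i.+1) = point (3 * y) sg (50 - 6 * y).
Proof. by rewrite p_tp // /hub /chain_point (X_half i.+1) !pointD; congr point; rewrite /y /sg; ring. Qed.
Let ptprev : p (tp s i) = point (6 * y) sg (50 - 12 * y).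
Proof. by rewrite p_tp ?(ltnW im) // /hub /chain_point (X_half i) (X_half i.+1) !pointD; congr point; rewrite /y /sg; ring. Qed.
Let ptprev' : p (tp (~~ s) i) = point (6 * y) (- sg) (50 - 12 * y).
Proof.
rewrite p_tp ?(ltnW im) // /hub /chain_point (X_half i) (X_half i.+1) !pointD; congr point; rewrite /y /sg; try ring.
by case: s => /=; ring.
Qed.

(* Up to terms vanishing with [y], the hub is seen from the chain vertex at about 170
   degrees from both tips, and the chain edges lie at about 27 degrees from the vertical. *)
Lemma obtuse_next : obtuse p (w i.+1) (tp s i.+1) (hv s) (24 / 25).
Proof.
rewrite /obtuse !(dotv_point pv ptnext phub, dotv_point pv ptnext ptnext, dotv_point pv phub phub).
rewrite !subr0 sg2.
have := y_gt0; have := y_le; have [? ? ? ? ?] := y_powers.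
move=> ? ?; split; lra.
Qed.

Lemma obtuse_prev : obtuse p (w i.+1) (hv s) (tp s i) (24 / 25).
Proof.
rewrite /obtuse !(dotv_point pv phub ptprev, dotv_point pv phub phub, dotv_point pv ptprev ptprev).
rewrite !subr0 sg2.
have := y_gt0; have := y_le; have [? ? ? ? ?] := y_powers.
move=> ? ?; split; lra.
Qed.

Lemma wide_next : wide p (w i.+1) (w i.+2) (tp s i.+1) (24 / 25).
Proof.
right; rewrite !(dotv_point pv pnext ptnext, dotv_point pv pnext pnext, dotv_point pv ptnext ptnext).
rewrite !subr0 sg2.
have := y_gt0; have := y_le; have [? ? ? ? ?] := y_powers.
(* The two sides differ by [y ^+ 2] times a quadratic polynomial; 213, 92 and -4 are its
   coefficients rounded down. *)
move=> ? ?; have := mulr_gt0 (exprn_gt0 2 y_gt0) (_ : 0 < 213 + 92 * y - 4 * y ^+ 2).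
by move=> /(_ ltac:(lra)); lra.
Qed.

Lemma wide_prev : wide p (w i.+1) (w i) (tp s i) (24 / 25).
Proof.
left; rewrite (dotv_point pv pprev ptprev) !subr0 mul0r.
have := y_gt0; have := y_le; have [? ? ? ? ?] := y_powers.
move=> ? ?; lra.
Qed.

(** The chain edge falls along (1, 0, -2) and the spike rises almost vertically, so the squared
    cosine is near 4/5: enough for 3/4, not for 24/25. *)
Lemma obtuse_chain : obtuse p (w i.+1) (tp s i) (w i) (3 / 4).
Proof.
rewrite /obtuse !(dotv_point pv ptprev pprev, dotv_point pv ptprev ptprev, dotv_point pv pprev pprev).
rewrite !subr0 sg2 !mulr0.
have := y_gt0; have := y_le; have [? ? ? ? ?] := y_powers.
move=> ? ?; split; lra.
Qed.

Lemma obtuse_chain' : obtuse p (w i.+1) (w i) (tp (~~ s) i) (3 / 4).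
Proof.
rewrite /obtuse !(dotv_point pv pprev ptprev', dotv_point pv ptprev' ptprev', dotv_point pv pprev pprev).
rewrite !subr0 mulrNN sg2 !mul0r.
have := y_gt0; have := y_le; have [? ? ? ? ?] := y_powers.
move=> ? ?; split; lra.
Qed.

Lemma wide_hub : wide p (w i.+1) (hv s) (tp s i) (3 / 4).
Proof.
left; rewrite (dotv_point pv phub ptprev) !subr0 sg2.
have := y_gt0; have := y_le; have [? ? ? ? ?] := y_powers.
move=> ? ?; lra.
Qed.

End Angles.

Lemma tri_perm (S : {set {set V}}) (x y z : V) : [set x; y; z] \in S ->
  [/\ [set y; z; x] \in S, [set z; x; y] \in S, [set x; z; y] \in S,
      [set z; y; x] \in S & [set y; x; z] \in S].
Proof.
move=> h; have e1 := set3_rot x y z; have e2 := set3_rot y z x; have e3 := set3_swap x y z.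
have e4 := set3_swap z x y; have e5 := set3_swap y z x.
by rewrite -e5 -e4 -e3 -e2 -e1 h.
Qed.

Lemma card_set_seq (U : finType) (A : {set U}) (l : seq U) : (#|[set x in A | x \in l]| <= size l)%N.
Proof.
by apply: leq_trans (card_size l); apply/subset_leq_card/subsetP => x; rewrite inE => /andP[].
Qed.

(** * Cuts forced on the spikes *)

Section Unfolding.
Variable C : {set {set V}}.
Hypothesis vC : valid_unfolding p (T n) C.

(** The corner consists of the chain face of the upper spike and the two faces along the hub edge:
    one angle of about 27 degrees and two of about 170. *)
Lemma cut_at_next (s : bool) i : (i.+1 < m)%N ->
  ([set w i.+1; tp s i.+1] \in C) || ([set w i.+1; hv s] \in C).
Proof.
move=> im; have im' := ltnW im.
have U : uniq [:: w i.+1; w i.+2; tp s i.+1; hv s; tp s i].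
  apply: (@vx_uniq [:: 3 * i.+1 + 1; 3 * i.+2 + 1; 3 * i.+1 + 5 + s; 2 * s; 3 * i + 5 + s]%N);
    rewrite /= ?inE; case: (s); lia.
have le1 : (3 * i.+1 + 2 + s <= n <= n)%N by case: (s); lia.
have le0 : (3 * i + 2 + s <= n <= n)%N by case: (s); lia.
have [h1 _ h3] := surf_spike im le1; have [_ g2 _] := surf_spike im' le0.
apply: (corner_cut final_unique vC U (eta := 24 / 25)); last exact: wide_next.
- by have [h _ _ _ _] := tri_perm h1; exact: h.
- by have [_ h _ _ _] := tri_perm h3; exact: h.
- by have [h _ _ _ _] := tri_perm g2; exact: h.
- lra.
- lra.
- exact: obtuse_next.
exact: obtuse_prev.
Qed.

Lemma cut_at_prev (s : bool) i : (i.+1 < m)%N ->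
  ([set w i.+1; tp s i] \in C) || ([set w i.+1; hv s] \in C).
Proof.
move=> im; have im' := ltnW im.
have U : uniq [:: w i.+1; w i; tp s i; hv s; tp s i.+1].
  apply: (@vx_uniq [:: 3 * i.+1 + 1; 3 * i + 1; 3 * i + 5 + s; 2 * s; 3 * i.+1 + 5 + s]%N);
    rewrite /= ?inE; case: (s); lia.
have le1 : (3 * i.+1 + 2 + s <= n <= n)%N by case: (s); lia.
have le0 : (3 * i + 2 + s <= n <= n)%N by case: (s); lia.
have [_ _ h3] := surf_spike im le1; have [g1 g2 _] := surf_spike im' le0.
apply: (corner_cut final_unique vC U (eta := 24 / 25)); last exact: wide_prev.
- by have [_ _ _ h _] := tri_perm g1; exact: h.
- by have [_ _ _ _ h] := tri_perm g2; exact: h.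
- by have [_ _ _ h _] := tri_perm h3; exact: h.
- lra.
- lra.
- exact: obtuseC (obtuse_prev s im).
exact: obtuseC (obtuse_next s im).
Qed.

(** The corner runs from a hub face across the chain edge into the opposite spike: about 170 degrees
    and twice about 153. *)
Lemma cut_at_chain (s : bool) i : (i.+1 < m)%N ->
  ([set w i.+1; tp s i] \in C) || ([set w i.+1; w i] \in C).
Proof.
move=> im; have im' := ltnW im.
have U : uniq [:: w i.+1; hv s; tp s i; w i; tp (~~ s) i].
  apply: (@vx_uniq [:: 3 * i.+1 + 1; 2 * s; 3 * i + 5 + s; 3 * i + 1; 3 * i + 5 + ~~ s]%N);
    rewrite /= ?inE; case: (s); lia.
have le0 (t : bool) : (3 * i + 2 + t <= n <= n)%N by case: t; lia.
have [g1 g2 _] := surf_spike im' (le0 s); have [k1 _ _] := surf_spike im' (le0 (~~ s)).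
apply: (corner_cut final_unique vC U (eta := 3 / 4)); last exact: wide_hub.
- by have [h _ _ _ _] := tri_perm g2; exact: h.
- by have [_ h _ _ _] := tri_perm g1; exact: h.
- by have [_ _ _ h _] := tri_perm k1; exact: h.
- lra.
- lra.
- exact: obtuse_chain.
exact: obtuse_chain'.
Qed.

Lemma cut_at_tip (s : bool) i : (i < m)%N ->
  [|| [set tp s i; hv s] \in C, [set tp s i; w i] \in C | [set tp s i; w i.+1] \in C].
Proof.
move=> im.
have U : uniq [:: tp s i; hv s; w i; w i.+1].
  apply: (@vx_uniq [:: 3 * i + 5 + s; 2 * s; 3 * i + 1; 3 * i.+1 + 1]%N); rewrite /= ?inE; case: (s); lia.
have kn : (3 * i + 1 + s < n)%N by case: (s); lia.
have le : (3 * i + 2 + s <= n <= n)%N by case: (s); lia.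
have [h1 h2 h3] := surf_spike im le.
apply: (tip_cut final_unique vC U) => //.
have [_ [/(_ _ kn)[_ [ind _]] _]] := construction_stacked.
by move: ind; rewrite /tet apex1E f1E -!setUA.
Qed.

Lemma T3n (F : {set V}) : F \in T n -> #|F| = 3%N.
Proof. exact: (surf_card3 f_in (leqnn n)). Qed.

Lemma sub_pair (F : {set V}) x y : x \in F -> y \in F -> [set x; y] \subset F.
Proof. by move=> xF yF; apply/subsetP => u; rewrite !inE => /orP[] /eqP->. Qed.

Lemma one_cut (F : {set V}) x y : F \in T n -> x \in F -> y \in F -> x != y -> [set x; y] \in C ->
  (#|uncut C F| <= 2)%N.
Proof.
by move=> FT xF yF xy eC; apply: (uncut_le2 T3n FT (sub_pair xF yF) _ eC); rewrite cards2 xy.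
Qed.

Lemma two_cuts (F : {set V}) x y z : F \in T n -> x \in F -> y \in F -> z \in F -> uniq [:: x; y; z] ->
  [set x; y] \in C -> [set x; z] \in C -> (#|uncut C F| <= 1)%N.
Proof.
move=> FT xF yF zF; rewrite /= !inE negb_or => /andP[/andP[xy xz] /andP[yz _]] e1 e2.
apply: (uncut_le1 T3n FT (sub_pair xF yF) _ e1 (sub_pair xF zF) _ e2); rewrite ?cards2 ?xy ?xz //.
by apply: (@neq_mem _ _ y); rewrite !inE ?eqxx ?orbT // negb_or eq_sym xy yz.
Qed.

Lemma spike_uniq (s : bool) i : (i < m)%N -> uniq [:: tp s i; hv s; w i; w i.+1].
Proof.
move=> im; apply: (@vx_uniq [:: 3 * i + 5 + s; 2 * s; 3 * i + 1; 3 * i.+1 + 1]%N);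
  rewrite /= ?inE; case: (s); lia.
Qed.

Lemma spike_in (s : bool) i F : (i < m)%N -> spike s i F -> F \in T n.
Proof.
move=> im sF; have le : (3 * i + 2 + s <= n <= n)%N by case: (s); lia.
by have [h1 h2 h3] := surf_spike im le; case: sF => ->.
Qed.

Ltac mem3 := by rewrite !inE eqxx ?orbT.

(** Each face of the spike contains both edges of one corner alternative. The face at the lower
    chain vertex takes it from the preceding index, hence [0 < i]. *)
Lemma spike_le2 (s : bool) i F : (0 < i)%N -> (i.+1 < m)%N -> spike s i F -> (#|uncut C F| <= 2)%N.
Proof.
case: i => // i _ im sF; have im' := ltnW im; have FT := spike_in im' sF.
have := spike_uniq s im'; rewrite /= !inE !negb_or => /and4P[/and3P[th tw tw'] /andP[hw hw'] ww _].
case: sF => eF.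
- case/orP: (cut_at_chain s im); apply: one_cut => //; rewrite ?eF 1?eq_sym //; mem3.
- case/orP: (cut_at_prev s im); apply: one_cut => //; rewrite ?eF 1?eq_sym //; mem3.
case/orP: (cut_at_next s im'); apply: one_cut => //; rewrite ?eF 1?eq_sym //; mem3.
Qed.

(* If the edge from the upper chain vertex to the tip is uncut, its two faces are cut along
   their chain and hub edges, and the cut needed at the tip is a second one; if it is cut
   and the hub edge is not, the next spike has two cuts on its chain face. *)
Lemma spike_good (s : bool) i : (0 < i)%N -> (i.+2 < m)%N -> exists j F,
  [/\ (i <= j <= i.+1)%N, spike s j F & (#|uncut C F| <= 1)%N].
Proof.
move=> _ im; have im' := ltnW im; have im'' := ltnW im'.
have := spike_uniq s im''; rewrite /= !inE !negb_or => /and4P[/and3P[th tw tw'] /andP[hw hw'] ww _].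
have [tuC|tuC] := boolP ([set w i.+1; tp s i] \in C).
  have [aC|aC] := boolP ([set w i.+1; hv s] \in C).
    exists i, [set tp s i; w i.+1; hv s]; split; [by rewrite leqnn leqnSn | by constructor 2 |].
    apply: (two_cuts _ _ _ _ _ tuC aC); try mem3; first by apply: (spike_in im''); constructor 2.
    by rewrite /= !inE negb_or eq_sym tw' eq_sym hw' th.
  have tlC : [set w i.+1; tp s i.+1] \in C by have := cut_at_next s im'; rewrite (negPf aC) orbF.
  exists i.+1, [set tp s i.+1; w i.+1; w i.+2]; split; [by rewrite leqnSn leqnn | by constructor 1 |].
  have := spike_uniq s im'; rewrite /= !inE !negb_or => /and4P[/and3P[sh sw sw'] /andP[gw gw'] vw _].
  have FT : [set tp s i.+1; w i.+1; w i.+2] \in T n by apply: (spike_in im'); constructor 1.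
  case/orP: (cut_at_chain s im) => e.
    apply: (@two_cuts _ (tp s i.+1) (w i.+1) (w i.+2)); rewrite // 1?setUC //; try mem3.
    by rewrite /= !inE negb_or sw sw' vw.
  apply: (@two_cuts _ (w i.+1) (tp s i.+1) (w i.+2)); rewrite // 1?setUC //; try mem3.
  by rewrite /= !inE negb_or eq_sym sw vw sw'.
have aC : [set w i.+1; hv s] \in C by have := cut_at_prev s im'; rewrite (negPf tuC).
have cC : [set w i.+1; w i] \in C by have := cut_at_chain s im'; rewrite (negPf tuC).
exists i; have := cut_at_tip s im''; rewrite [[set tp s i; w i.+1]]setUC (negPf tuC) orbF => /orP[e|e].
  exists [set tp s i; w i.+1; hv s]; split; [by rewrite leqnn leqnSn | by constructor 2 |].
  apply: (@two_cuts _ (hv s) (tp s i) (w i.+1)); rewrite 1?[[set hv s; _]]setUC //; try mem3.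
    by apply: (spike_in im''); constructor 2.
  by rewrite /= !inE negb_or eq_sym th hw' tw'.
exists [set tp s i; w i; w i.+1]; split; [by rewrite leqnn leqnSn | by constructor 1 |].
apply: (@two_cuts _ (w i) (tp s i) (w i.+1)); rewrite 1?[[set w i; _]]setUC //; try mem3.
  by apply: (spike_in im''); constructor 1.
by rewrite /= !inE negb_or eq_sym tw ww tw'.
Qed.

Lemma spike_index (s : bool) i j F : (i < m)%N -> (j < m)%N -> spike s i F -> spike s j F -> i = j.
Proof.
move=> im jm si sj.
have tF : tp s i \in F by case: si => ->; rewrite !inE eqxx.
have [a [b [ea eb ec]]] : exists a b, [/\ F = [set tp s j; a; b], hub_or_chain a & hub_or_chain b].
  have hh : hub_or_chain (hv s) by rewrite /hub_or_chain vxE; case: (s).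
  have hw : forall l, (l <= m)%N -> hub_or_chain (w l) by move=> l lm; rewrite /hub_or_chain vxE; lia.
  by case: sj => ->; [exists (w j), (w j.+1) | exists (w j.+1), (hv s) | exists (hv s), (w j)];
    split=> //; apply: hw => //; exact: ltnW.
have := tp_other s im; move: tF; rewrite ea !inE => /orP[/orP[]|] /eqP e; rewrite ?e ?eb ?ec //.
by move: e => /vx_inj; case: (s); lia.
Qed.

(** Four faces outside the spikes and the twelve faces of the end spikes, where a corner lacks a
    neighbouring spike: 16 in all. *)
Definition irregular : seq {set V} :=
  [:: [set dd; hv false; hv true]; [set dd; hv false; w 0]; [set dd; hv true; w 0]; [set hv false; hv true; w m]] ++
  flatten [seq [:: [set tp a.1 a.2; w a.2; w a.2.+1]; [set tp a.1 a.2; w a.2.+1; hv a.1]; [set tp a.1 a.2; hv a.1; w a.2]]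
    | a <- [:: (false, 0%N); (true, 0%N); (false, m.-1); (true, m.-1)]].

Lemma irregularP F : (0 < m)%N -> F \in T n -> F \notin irregular ->
  exists s i, [/\ (0 < i)%N, (i.+1 < m)%N & spike s i F].
Proof.
move=> m0 /(surf_desc (leqnn m)) D nF.
have {}nF G : G \in irregular -> F <> G by move=> GI FG; move: nF; rewrite FG GI.
case: D => [e|e|[s e]|[s [i [im sF]]]].
- by case: (nF _ _ e); rewrite !inE eqxx !orbT.
- by case: (nF _ _ e); rewrite !inE eqxx.
- by case: (nF _ _ e); case: (s); rewrite !inE eqxx ?orbT.
exists s, i; split=> //.
  rewrite lt0n; apply/eqP => i0; move: sF; rewrite i0.
  by case=> e; case: (nF _ _ e); case: (s); rewrite !inE eqxx ?orbT.
rewrite ltn_neqAle im andbT; apply/eqP => iM; have {}iM : i = m.-1 by rewrite -iM.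
by move: sF; rewrite iM; case=> e; case: (nF _ _ e); case: (s); rewrite !inE eqxx ?orbT.
Qed.

Lemma many_pieces N : m = (2 * (16 + 2 * N) + 2)%N -> (N <= #|pieces (T n) C|)%N.
Proof.
move=> em; set M := (16 + 2 * N)%N in em.
(* The index pairs 2l+1, 2l+2 are disjoint for distinct [l], so the chosen faces are distinct. They
   number [16 + 2 * N]: 16 pay for the irregular faces, and each piece accounts for two of the
   rest. *)
have ex (l : 'I_M) : exists F, exists j, [/\ (2 * l + 1 <= j <= 2 * l + 2)%N, spike false j F & (#|uncut C F| <= 1)%N].
  have lM := ltn_ord l; have [||j [F [h1 h2 h3]]] := @spike_good false (2 * l + 1); try lia.
  by exists F, j; split=> //; lia.
have [g gP] := choice ex.
have gT l : g l \in T n.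
  by have [j [h1 h2 _]] := gP l; apply: spike_in h2; have := ltn_ord l; lia.
pose Gd := [set g l | l in 'I_M].
have cG : #|Gd| = M.
  rewrite card_imset ?card_ord // => l l' e; apply/ord_inj.
  have [j [h1 h2 _]] := gP l; have [j' [h1' h2' _]] := gP l'.
  have := ltn_ord l; have := ltn_ord l'; move=> lM' lM.
  rewrite -e in h2'; have := spike_index _ _ h2 h2'; lia.
pose S := [set F in T n | F \in irregular].
have cS : (#|S| <= 16)%N by exact: (card_set_seq (T n) irregular).
have : (#|Gd| <= #|S| + 2 * #|pieces (T n) C|)%N.
  apply: (pieces_lower T3n (surf_manifold f_in (leqnn n))).
  - by apply/subsetP => F; rewrite inE => /andP[].
  - by apply/subsetP => F /imsetP[l _ ->]; exact: gT.
  - move=> F; rewrite in_setD => /andP[nF FT].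
    have {}nF : F \notin irregular by apply: contra nF => FI; rewrite in_set FT.
    have m0 : (0 < m)%N by lia.
    by have [s [i [i0 iM sF]]] := irregularP m0 FT nF; apply: spike_le2 sF.
  by move=> F /imsetP[l _ ->]; have [j []] := gP l.
rewrite cG /M; lia.
Qed.

End Unfolding.

End Construction.

Theorem theorem4 (R : realType) (N : nat) : (0 < N)%N ->
  exists (n : nat) (f : nat -> {set 'I_n.+4}) (p : 'I_n.+4 -> 'rV[R]_3),
    stacked p f /\ top_convex p (surf f n) /\
    forall C : {set {set 'I_n.+4}},
      valid_unfolding p (surf f n) C -> (N <= #|pieces (surf f n) C|)%N.
Proof.
move=> _; set m := (2 * (16 + 2 * N) + 2)%N.
exists (3 * m)%N, (@glued_face m), (@position R m); split; first exact: construction_stacked.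
split; first exact: construction_convex.
by move=> C vC; apply: (many_pieces vC).
Qed.
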